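(* Assume A1 and A2 (stated in the context), and let $f:\mathsf X\to\mathbb R^d$ be a bounded measurable function, centered with respect to $\pi$ (i.e. $\pi(f)=0$). Then, for any initial probability measure $\mu$ satisfying $\mu(V)<\infty$, there exist $L,K$ and, for any $\varepsilon>0$, an integer $n_0(\varepsilon)$, with $L,K$ independent of $n$ and $\varepsilon$, such that for all $n>n_0(\varepsilon)$ and all $y>0$, $$\mathbb P_\mu\left(\left\|\sum_{k=0}^{n-1}f(X_k)\right\|>\varepsilon n\right)\le\frac{Ln}{\Phi^{-1}\left(\frac{\varepsilon n}{\|f\|_\infty}\right)}+\frac{Ln}{\Phi^{-1}\left(\frac{y}{\|f\|_\infty}\right)}+\exp\left(-\frac{n\varepsilon^2}{K\|f\|_\infty^2+\varepsilon y}\right).$$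
   Context: $P$ is the transition kernel of a positive Harris recurrent Markov chain $\{X_k\}_{k\ge0}$ on a measurable space $(\mathsf X,\mathcal X)$ with countably generated $\mathcal X$; $\pi$ is its invariant probability and $\mathbb P_\mu$ the law of the chain with initial distribution $\mu$. A1: there exist $C\in\mathcal X$, $\epsilon\in(0,1]$ and a probability measure $\nu$ on $(\mathsf X,\mathcal X)$ with $\nu(C)=1$ and $P(x,A)\ge\epsilon\nu(A)$ for all $x\in C$, $A\in\mathcal X$. A2: there exist a concave, non-decreasing, differentiable function $\varphi:[1,\infty)\to\mathbb R^+$, a measurable function $V:\mathsf X\to[1,\infty)$ and a positive constant $b$ with $\varphi(1)>0$, $\lim_{v\to\infty}\varphi(v)=\infty$, $\lim_{v\to\infty}\varphi'(v)=0$, $\sup_C V<\infty$ and $PV\le V-\varphi\circ V+b\mathbf 1_C$, with $C$ the set in A1. $\Phi(v)=\int_1^v dx/\varphi(x)$, an increasing bijection of $[1,\infty)$ onto $[0,\infty)$ with inverse $\Phi^{-1}$. $\|\cdot\|$ is the Euclidean norm and $\|f\|_\infty=\sup_{x\in\mathsf X}\|f(x)\|$ (with $f\not\equiv0$). *)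

(* Defs.v *)
From HB Require Import structures.
From mathcomp Require Import all_boot all_order all_algebra.
From mathcomp Require Import all_classical all_reals all_analysis.

Set Implicit Arguments.
Unset Strict Implicit.
Unset Printing Implicit Defensive.

Import Order.TTheory GRing.Theory Num.Theory.
Import numFieldNormedType.Exports.

Local Open Scope classical_set_scope.
Local Open Scope ring_scope.

Definition countably_generated d (T : measurableType d) : Prop :=
  exists2 G : set (set T), countable G & @measurable d T = <<s G >>.

Definition natural_filtration d (T : measurableType d) d'
    (Omega : measurableType d') (X : nat -> Omega -> T) (n : nat) :
    set (set Omega) :=
  <<s \bigcup_(k in `I_n.+1) preimage_set_system setT (X k) measurable >>.

(* The last clause says that P (X_n, A) is a version of the conditional
   probability of {X_(n+1) \in A} given sigma(X_0, ..., X_n).  The law of the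
   process X on the sequence space is thereby the one usually written P_mu. *)
Definition markov_chain (R : realType) d (T : measurableType d)
    (P : R.-pker T ~> T) (mu : probability T R)
    d' (Omega : measurableType d') (Pr : probability Omega R)
    (X : nat -> {RV Pr >-> T}) : Prop :=
  (forall A, measurable A -> distribution Pr (X 0%N) A = mu A) /\
  (forall n A E, measurable A ->
    natural_filtration (fun k => X k : Omega -> T) n E ->
    (Pr (E `&` X n.+1 @^-1` A) = \int[Pr]_(w in E) P (X n w) A)%E).

Definition harris_recurrent (R : realType) d (T : measurableType d)
    (P : R.-pker T ~> T) : Prop :=
  exists psi : {measure set T -> \bar R},
    [/\ sigma_finite setT psi,
        psi setT != 0%E &
        forall A, measurable A -> (0 < psi A)%E ->
        forall (x : T) d' (Omega : measurableType d')
          (Pr : probability Omega R) (X : nat -> {RV Pr >-> T}),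
          markov_chain P (\d_x : probability T R) X ->
          Pr (lim_sup_set (fun n => X n @^-1` A)) = 1%E].

Definition positive_harris_recurrent (R : realType) d (T : measurableType d)
    (P : R.-pker T ~> T) (pi : probability T R) : Prop :=
  harris_recurrent P /\
  (forall A, measurable A -> (\int[pi]_x P x A = pi A)%E).

Definition minorization (R : realType) d (T : measurableType d)
    (P : R.-pker T ~> T) (C : set T) : Prop :=
  measurable C /\
  exists (eps : R) (nu : probability T R),
    [/\ 0 < eps <= 1,
        nu C = 1%E &
        forall x A, C x -> measurable A -> (eps%:E * nu A <= P x A)%E].

Definition concave_on (R : realType) (D : set R) (f : R -> R) : Prop :=
  convex_function (D : set R^o) (fun x => - f x : R^o).

(* Differentiability on the half-line [1, +oo[: one-sided at the end point,
   the values of f on ]-oo, 1[ being irrelevant. *)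
Definition differentiable_1y (R : realType) (f : R -> R) : Prop :=
  (forall v, 1 < v -> derivable f v 1) /\
  cvg (h^-1 * (f (1 + h) - f 1) @[h --> 0^'+]).

Definition drift_condition (R : realType) d (T : measurableType d)
    (P : R.-pker T ~> T) (C : set T) (phi : R -> R) (V : T -> R) : Prop :=
  [/\ [/\ forall v, 1 <= v -> 0 <= phi v,
          concave_on `[1, +oo[ phi,
          {in `[1, +oo[ &, {homo phi : v w / v <= w}} &
          differentiable_1y phi],
      [/\ 0 < phi 1,
          phi v @[v --> +oo] --> +oo &
          derive1 phi v @[v --> +oo] --> 0],
      [/\ measurable_fun setT V,
          forall x, 1 <= V x &
          has_ubound (V @` C)] &
      exists2 b : R, 0 < b &
        forall x, (\int[P x]_y (V y)%:E <=
                   (V x - phi (V x) + b * \1_C x)%:E)%E].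

Definition Phi (R : realType) (phi : R -> R) (v : R) : R :=
  \int[lebesgue_measure]_(x in `[1, v]) (phi x)^-1.

(* The default value 1 is only taken outside the image of [1, +oo[ under
   Phi phi. *)
Definition Phi_inv (R : realType) (phi : R -> R) : R -> R :=
  'pinv_(fun=> 1) `[1, +oo[ (Phi phi).

(* The library norm on row vectors is the sup norm, hence this definition. *)
Definition enorm (R : realType) (d : nat) (v : 'rV[R]_d) : R :=
  Num.sqrt (\sum_(i < d) v ord0 i ^+ 2).

Definition supnorm (R : realType) (T : Type) (d : nat) (f : T -> 'rV[R]_d) : R :=
  sup (range (fun x => enorm (f x))).

(* Main.v *)
(** Let the age [j_k] be the number of steps taken since time 0, reset to 0 one
    step after each visit of the chain to [C], let
    [G_j v = Phi^-1 (Phi v + j)], and fix a level [t] (in the end [t = y / |f|]).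

    The function [G_j] is concave and [Phi (v - phi v) + 1 <= Phi v].  By the
    drift condition, [G_(j_k) (V X_k)] is therefore a supermartingale between
    visits to [C], and after a visit its conditional mean is at most
    [B = sup_C V + b].  Doob's maximal inequality then bounds the probability that
    [Phi (V X_k) + j_k] exceeds [t] before time [n] by
    [(mu V + B n) / Phi^-1 t].

    On the complementary event one uses, for each component [f] of the given
    function, a solution of Poisson's equation [g - P g = f] with
    [g = O(Phi o V + 1)]: it is [g = sum_k R^k f] for the kernel
    [R = P - eps 1_C nu], and [nu g = 0] because
    [eps pi(C) nu (sum_k R^k h) = pi h] for every bounded [h].  For [l = A / t] and
    [t] large the function
      [W_j x = 1 + l g x + l kap (G_j (V x)) exp (- a l j)]
    is at least 1/2 and satisfies
    [exp (l (f x - e / 2)) P W_(j') x <= W_j x] as long as [Phi (V x) + j <= t];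
    second moments, which may be infinite, do not enter.  Hence, on that event,
    [sum_(k < n) f X_k > e n] has probability at most [4 exp (- A e n / (2 t))].

    As [A] is arbitrary, the exponential term of the statement is beaten by a large
    margin, which absorbs the factor 4, the dimension and [K].  When [y] exceeds a
    small multiple of [eps n], the estimate is applied at that multiple instead;
    the remaining term is then small because [Phi^-1] grows superlinearly. *)

Require Import Defs.
From HB Require Import structures.
From mathcomp Require Import all_boot all_order all_algebra.
From mathcomp Require Import all_classical all_reals all_analysis.
From mathcomp Require Import measurable_realfun ring lra.

Set Implicit Arguments.
Unset Strict Implicit.
Unset Printing Implicit Defensive.

Import Order.TTheory GRing.Theory Num.Theory.
Import numFieldNormedType.Exports.

Local Open Scope classical_set_scope.
Local Open Scope ring_scope.

(** * The function [Phi] *)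

Lemma concave_on_three_points (R : realType) (D : set R) (h : R -> R) (p q r : R) :
  concave_on D h -> D p -> D r -> p < q -> q < r ->
  (h r - h q) * (q - p) <= (h q - h p) * (r - q).
Proof.
move=> conc Dp Dr pq qr.
have rp0 : 0 < r - p by rewrite subr_gt0 (lt_trans pq).
have s01 : 0 <= (q - p) / (r - p) <= 1.
  rewrite divr_ge0 ?subr_ge0 ?(ltW pq) ?(ltW (lt_trans pq qr))//=.
  by rewrite ler_pdivrMr// mul1r lerD2r ltW.
pose s : {i01 R} := Itv01 (andP s01).1 (andP s01).2.
pose u := (q - p) / (r - p).
have cv : - h (u * r + (1 - u) * p) <= u * - h r + (1 - u) * - h p :=
  conc s r p (mem_set Dr) (mem_set Dp).
have rpn : r - p != 0 by rewrite gt_eqF.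
have uq : u * r + (1 - u) * p = q by rewrite /u; field.
have uE : u * (r - p) = q - p by rewrite /u divfK.
rewrite uq in cv.
have := ler_wpM2r (ltW rp0) cv.
have -> : (u * - h r + (1 - u) * - h p) * (r - p)
   = - (u * (r - p)) * h r - ((r - p) - u * (r - p)) * h p by ring.
rewrite uE; lra.
Qed.

(** Both chords are compared with the chord over [p, q']. Slopes are cross-multiplied, and the cases
    q = q' and p = p' are split off because [concave_on_three_points] needs strict inequalities. *)
Lemma concave_on_slopes (R : realType) (a : R) (h : R -> R) (p q p' q' : R) :
  concave_on `[a, +oo[ h -> a <= p -> p < q -> p' < q' -> p <= p' -> q <= q' ->
  (h q' - h p') * (q - p) <= (h q - h p) * (q' - p').
Proof.
move=> conc ap pq pq' pp' qq'.
have D z : a <= z -> `[a, +oo[%classic z by move=> az; rewrite /= in_itv/= az.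
have h1 : (h q' - h p) * (q - p) <= (h q - h p) * (q' - p).
  have [->//|nqq'] := eqVneq q q'.
  have lt_qq' : q < q' by rewrite lt_neqAle nqq'.
  have aq' : a <= q' by lra.
  have := concave_on_three_points conc (D _ ap) (D _ aq') pq lt_qq'.
  lra.
have h2 : (h q' - h p') * (q' - p) <= (h q' - h p) * (q' - p').
  have [->//|npp'] := eqVneq p p'.
  have lt_pp' : p < p' by rewrite lt_neqAle npp'.
  have aq' : a <= q' by lra.
  have := concave_on_three_points conc (D _ ap) (D _ aq') lt_pp' pq'.
  lra.
have qp0 : 0 < q' - p by lra.
rewrite -(ler_pM2r qp0).
have h1' := ler_wpM2r (ltW (_ : 0 < q' - p')) h1.
have h2' := ler_wpM2r (ltW (_ : 0 < q - p)) h2.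
apply: (@le_trans _ _ ((h q' - h p) * (q - p) * (q' - p'))).
  by rewrite [leLHS]mulrAC [leRHS]mulrAC; apply: h2'; rewrite subr_gt0.
rewrite [leRHS]mulrAC; apply: h1'; rewrite subr_gt0//.
Qed.

(* Sum the hypothesis over a partition of [x, y] into N equal pieces: the
   right-hand sides telescope to - (y - x) / N * (b x - b y). *)
Lemma homo_of_small_increments (R : realType) (D b : R -> R) (x y : R) :
  x <= y ->
  (forall r r', x <= r -> r <= r' -> r' <= y ->
     - ((r' - r) * (b r - b r')) <= D r' - D r) ->
  D x <= D y.
Proof.
move=> xy inc.
have part N : - ((y - x) / N.+1%:R * (b x - b y)) <= D y - D x.
  pose h := (y - x) / N.+1%:R.
  have h0 : 0 <= h by rewrite divr_ge0// subr_ge0.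
  pose c (i : nat) := x + h * i%:R.
  have cN : c N.+1 = y by rewrite /c /h divfK// addrC subrK.
  have c0 : c 0%N = x by rewrite /c mulr0 addr0.
  have step i : (i <= N.+1)%N -> - (h * (b x - b (c i))) <= D (c i) - D x.
    elim: i => [|i IH] iN; first by rewrite c0 !subrr mulr0 oppr0.
    have /IH {}IH : (i <= N.+1)%N by exact: ltnW.
    have ci : c i.+1 - c i = h by rewrite /c -natr1; ring.
    have cx : x <= c i by rewrite /c lerDl mulr_ge0.
    have cc : c i <= c i.+1 by rewrite -subr_ge0 ci.
    have cy : c i.+1 <= y.
      by rewrite -cN /c lerD2l ler_wpM2l// ler_nat.
    have := inc _ _ cx cc cy; rewrite ci; lra.
  by have := step _ (leqnn N.+1); rewrite cN.
rewrite -subr_ge0; apply/ler_addgt0Pl => e e0.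
rewrite -lerBlDl sub0r.
pose Z := (y - x) * `|b x - b y|.
have Z0 : 0 <= Z by rewrite mulr_ge0 ?subr_ge0.
apply: le_trans (part (Num.truncn (Z / e))).
rewrite lerN2 mulrAC ler_pdivrMr ?ltr0n//.
have : Z / e < (Num.truncn (Z / e)).+1%:R by apply: truncnS_gt.
rewrite ltr_pdivrMr// => /ltW ?.
rewrite [leRHS]mulrC.
apply: le_trans (_ : Z <= _); last by [].
by rewrite ler_wpM2l ?subr_ge0// ler_norm.
Qed.

Section Phi_theory.
Context (R : realType) (phi : R -> R).
Hypothesis phi_ge0 : forall v, 1 <= v -> 0 <= phi v.
Hypothesis phi_conc : concave_on `[1, +oo[ phi.
Hypothesis phi_homo : {in `[1, +oo[ &, {homo phi : v w / v <= w}}.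
Hypothesis phi1 : 0 < phi 1.
Hypothesis phi_y : phi v @[v --> +oo] --> +oo.
Notation Phi := (Phi phi).
Notation Phi_inv := (Phi_inv phi).

Let in1y (v : R) : 1 <= v -> v \in `[1, +oo[.
Proof. by rewrite in_itv/= andbT. Qed.

Lemma phi_le (v w : R) : 1 <= v -> v <= w -> phi v <= phi w.
Proof. by move=> v1 vw; apply: phi_homo => //; apply: in1y => //; apply: le_trans vw. Qed.

Lemma phi_gt0 (v : R) : 1 <= v -> 0 < phi v.
Proof. by move=> v1; apply: lt_le_trans phi1 _; apply: phi_le. Qed.

Lemma inv_phi_le (v w : R) : 1 <= v -> v <= w -> (phi w)^-1 <= (phi v)^-1.
Proof.
move=> v1 vw; have w1 := le_trans v1 vw.
by rewrite lef_pV2 ?posrE ?phi_gt0// phi_le.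
Qed.

Lemma inv_phi_integrable (v w : R) : 1 <= v ->
  lebesgue_measure.-integrable `[v, w] (EFin \o (fun x => (phi x)^-1)).
Proof.
move=> v1; apply: measurable_bounded_integrable => //.
- rewrite [X in (X < _)%E](_ : _ = lebesgue_measure `[v, w]%classic)//.
  by rewrite lebesgue_measure_itv; case: ifP => _; rewrite ltry.
(* [phi] is monotone only on [1, +oo[; replacing x by max 1 x changes nothing on [v, w] and makes
   the integrand monotone on the whole line, hence measurable. *)
- apply: (@eq_measurable_fun _ _ _ _ _ (fun x : R => (phi (Num.max 1 x))^-1)).
    move=> x; rewrite inE/= in_itv/= => /andP[vx _].
    by rewrite max_r// (le_trans v1).
  apply: nonincreasing_measurable => //.
  move=> x y xy; apply: inv_phi_le; first by rewrite le_max lexx.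
  by rewrite ge_max !le_max lexx xy/= orbT.
- exists (phi 1)^-1; split; first by rewrite num_real.
  move=> M M1 x /=; rewrite in_itv/= => /andP[vx _].
  have x1 := le_trans v1 vx.
  rewrite ger0_norm ?invr_ge0 ?phi_ge0//.
  by apply: le_trans (ltW M1); rewrite inv_phi_le.
Qed.

(** The integrand 1 / phi is nonincreasing, so on ]v, w] it lies between its end values. This
    two-sided estimate stands in for the derivative of [Phi] below. *)
Lemma Phi_sub (v w : R) : 1 <= v -> v <= w ->
  (w - v) / phi w <= Phi w - Phi v <= (w - v) / phi v.
Proof.
move=> v1 vw; have w1 := le_trans v1 vw.
rewrite /Defs.Phi (Rintegral_itvB (inv_phi_integrable _ _)) ?bnd_simp//.
have iD : lebesgue_measure.-integrable `]v, w] (EFin \o (fun x => (phi x)^-1)).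
  apply: integrableS (inv_phi_integrable w v1) => //.
  by apply: subset_itvr; rewrite bnd_simp.
have ic (c : R) : lebesgue_measure.-integrable `]v, w] (EFin \o cst c).
  apply: integrableS (_ : lebesgue_measure.-integrable `[v, w] _) => //.
    by apply: subset_itvr; rewrite bnd_simp.
  by apply/continuous_compact_integrable;
     [exact: segment_compact|exact: cst_continuous].
have cE (c : R) : \int[lebesgue_measure]_(x in `]v, w]) c = (w - v) * c.
  rewrite Rintegral_cst//.
  transitivity (c * fine (lebesgue_measure `]v, w]%classic)) => //.
  rewrite lebesgue_measure_itv/= lte_fin.
  case: ltP => [_|wv]; first by rewrite mulrC -EFinD.
  have -> : v = w by apply/le_anti/andP.
  by rewrite subrr mul0r mulr0.
apply/andP; split; rewrite -cE; apply: le_Rintegral => //; try exact: ic.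
  move=> x /=; rewrite in_itv/= => /andP[vx xw]; apply: inv_phi_le => //.
  exact: ltW (le_lt_trans v1 vx).
move=> x /=; rewrite in_itv/= => /andP[vx xw]; apply: inv_phi_le => //.
exact: ltW.
Qed.

Lemma Phi1 : Phi 1 = 0.
Proof. by rewrite /Defs.Phi set_itv1 Rintegral_set1. Qed.

Lemma Phi_lt (v w : R) : 1 <= v -> v < w -> Phi v < Phi w.
Proof.
move=> v1 vw; rewrite -subr_gt0.
have /andP[+ _] := Phi_sub v1 (ltW vw); apply: lt_le_trans.
by rewrite divr_gt0 ?subr_gt0// phi_gt0// (le_trans v1)// ltW.
Qed.

Lemma Phi_le (v w : R) : 1 <= v -> v <= w -> Phi v <= Phi w.
Proof. by move=> v1; rewrite le_eqVlt => /predU1P[->//|/(Phi_lt v1)/ltW]. Qed.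

Lemma Phi_ge0 (v : R) : 1 <= v -> 0 <= Phi v.
Proof. by move=> v1; rewrite -Phi1 Phi_le. Qed.

Lemma Phi_le_inv (v w : R) : 1 <= v -> 1 <= w -> Phi v <= Phi w -> v <= w.
Proof.
by move=> v1 w1; apply: contraTT; rewrite -!ltNge => wv; exact: Phi_lt.
Qed.

(** Concavity of [Phi], whose slope at v is 1 / phi v. *)
Lemma Phi_tangent (v w : R) : 1 <= v -> 1 <= w ->
  Phi w <= Phi v + (w - v) / phi v.
Proof.
move=> v1 w1; have [vw|/ltW wv] := leP v w.
  by have /andP[_] := Phi_sub v1 vw; lra.
have /andP[+ _] := Phi_sub w1 wv.
by rewrite -(opprB v w) mulNr; lra.
Qed.

(** Beyond 2 a concave function stays below the extension of its chord from 1 to 2. Linear growth of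
    [phi] makes the integral of 1 / phi diverge. *)
Lemma phi_le_linear (v : R) : 1 <= v -> phi v <= phi 2 * v.
Proof.
move=> v1; have p2 := @phi_gt0 2 (ler1n _ 2).
have [v2|v2] := leP v 2.
  apply: (@le_trans _ _ (phi 2)); first exact: phi_le.
  by rewrite ler_peMr// ltW.
have h12 : (1 : R) < 2 by rewrite ltr1n.
have h11 : `[1, +oo[%classic (1 : R) by rewrite /= in_itv/= lexx.
have h1v : `[1, +oo[%classic v by rewrite /= in_itv/= v1.
have := concave_on_three_points phi_conc h11 h1v h12 v2.
have := phi1; nra.
Qed.

(** By the linear growth of [phi], every doubling of the argument adds at least 1 / (2 phi 2) to
    [Phi]. *)
Lemma Phi_unbounded (t : R) : exists2 v, 1 <= v & t <= Phi v.
Proof.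
have p2 := @phi_gt0 2 (ler1n _ 2).
have double k : k%:R / (2 * phi 2) <= Phi (2 ^+ k).
  elim: k => [|k IH]; first by rewrite expr0 Phi1 mul0r.
  have k1 : (1 : R) <= 2 ^+ k by rewrite exprn_ege1// ler1n.
  have kS : (2 : R) ^+ k <= 2 ^+ k.+1.
    by rewrite exprS ler_peMl// ?(le_trans ler01 k1)// ler1n.
  have /andP[+ _] := Phi_sub k1 kS.
  have -> : (2 : R) ^+ k.+1 - 2 ^+ k = 2 ^+ k by rewrite exprS; ring.
  have kS1 := le_trans k1 kS.
  have : (2 * phi 2)^-1 <= 2 ^+ k / phi (2 ^+ k.+1).
    rewrite ler_pdivlMr ?phi_gt0// mulrC ler_pdivrMr ?mulr_gt0//.
    by have := phi_le_linear kS1; rewrite [X in _ <= _ * X]exprS; lra.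
  move=> h1 h2; have := lerD IH (le_trans h1 h2).
  by rewrite [X in _ <= X]addrC subrK -[k.+1%:R]natr1 [(_ + 1) / _]mulrDl mul1r.
exists (2 ^+ (Num.truncn (t * (2 * phi 2))).+1).
  by rewrite exprn_ege1// ler1n.
apply: le_trans (double _); rewrite ler_pdivlMr ?mulr_gt0//.
exact/ltW/truncnS_gt.
Qed.

(** [Phi] is Lipschitz on [1, +oo[ with constant 1 / phi 1, hence continuous, and the intermediate
    value theorem applies. *)
Lemma Phi_surj (t : R) : 0 <= t -> exists2 v, 1 <= v & Phi v = t.
Proof.
move=> t0; have [w w1 tw] := Phi_unbounded t.
have lip (e x y : R) : 1 <= x -> 1 <= y -> `|x - y| <= e * phi 1 ->
    `|Phi x - Phi y| <= e.
  wlog yx : x y / y <= x.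
    move=> H; have [|/ltW yx x1 y1 xy] := leP y x; first exact: H.
    by rewrite distrC; apply: H => //; rewrite distrC.
  move=> x1 y1; rewrite !ger0_norm ?subr_ge0 ?Phi_le// => xy.
  have /andP[_ /le_trans->]// := Phi_sub y1 yx.
  rewrite ler_pdivrMr ?phi_gt0//; apply: (le_trans xy).
  apply: ler_wpM2l; last exact: phi_le.
  have : 0 <= e * phi 1 by apply: le_trans xy; rewrite subr_ge0.
  by rewrite pmulr_lge0.
have cont : {within `[1, w], continuous Phi}.
  apply/subspace_continuousP => x /=; rewrite in_itv/= => /andP[x1 _].
  apply/cvgrPdist_le => /= e e0.
  have d0 : 0 < e * phi 1 by rewrite mulr_gt0.
  have nb : \forall y \near x, `|x - y| <= e * phi 1.
    by exists (e * phi 1) => //= z /= /ltW.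
  rewrite near_withinE; apply: filterS nb => y xy.
  by rewrite /= in_itv/= => /andP[y1 _]; apply: lip.
have [] := @IVT R Phi 1 w t w1 cont.
  rewrite Phi1 ge_min le_max t0 tw/= orbT//.
by move=> v; rewrite in_itv/= => /andP[v1 _] <-; exists v.
Qed.

Lemma PhiK (v : R) : 1 <= v -> Phi_inv (Phi v) = v.
Proof.
move=> v1; rewrite /Defs.Phi_inv pinvKV//; last by rewrite inE/= in1y.
move=> x y; rewrite !inE/= !in_itv/= !andbT => x1 y1 xy.
by apply/le_anti/andP; split; apply: Phi_le_inv => //; rewrite xy.
Qed.

Lemma Phi_inv_spec (t : R) : 0 <= t -> 1 <= Phi_inv t /\ Phi (Phi_inv t) = t.
Proof. by move=> /Phi_surj[v v1 <-]; rewrite PhiK. Qed.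

Lemma Phi_inv_ge1 (t : R) : 0 <= t -> 1 <= Phi_inv t.
Proof. by case/Phi_inv_spec. Qed.

Lemma Phi_invK (t : R) : 0 <= t -> Phi (Phi_inv t) = t.
Proof. by case/Phi_inv_spec. Qed.

Lemma Phi_inv_le (s t : R) : 0 <= s -> s <= t -> Phi_inv s <= Phi_inv t.
Proof.
move=> s0 st; have t0 := le_trans s0 st.
by apply: Phi_le_inv; rewrite ?Phi_inv_ge1// !Phi_invK.
Qed.

(** Since [phi] tends to infinity, the slope 1 / phi v1 is at most e / 2 for some v1; the tangent at
    v1 then leaves e / 2 per unit to absorb the constant Phi v1 + 1. This is the superlinear growth
    of Phi^-1. *)
Lemma Phi_sublinear (e : R) : 0 < e ->
  exists2 v0, 1 <= v0 & forall v, v0 <= v -> Phi v + 1 <= e * v.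
Proof.
move=> e0; move/cvgryPge : phi_y => /(_ (2 / e)) [a [_ ha]].
pose v1 := Num.max 1 (a + 1).
have v11 : 1 <= v1 by rewrite le_max lexx.
have hv1 : 2 / e <= phi v1.
  by apply: ha; rewrite lt_max ltrDl ltr01 orbT.
pose c := Phi v1 + 1.
have c0 : 0 <= c by rewrite addr_ge0// Phi_ge0.
exists (v1 + 2 * c / e).
  by rewrite (le_trans v11)// lerDl divr_ge0 ?mulr_ge0// ltW.
move=> v hv.
have v1v : v1 <= v.
  by apply: le_trans hv; rewrite lerDl divr_ge0 ?mulr_ge0// ltW.
have := Phi_tangent v11 (le_trans v11 v1v).
have : (v - v1) / phi v1 <= (v - v1) * (e / 2).
  by rewrite ler_wpM2l ?subr_ge0// -[e / 2]invrK lef_pV2 ?posrE ?invf_div ?divr_gt0// phi_gt0.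
have : (v - v1) * e >= 2 * c.
  by rewrite -ler_pdivrMr//; lra.
rewrite /c; have : 0 < v1 * e by rewrite mulr_gt0// (lt_le_trans ltr01).
lra.
Qed.

End Phi_theory.

(** * The flow of [v' = phi v] *)

(* The level v of the drift function, moved forward by time t along the
   solution of v' = phi v. *)
Definition phi_flow (R : realType) (phi : R -> R) (t v : R) : R :=
  Phi_inv phi (Phi phi v + t).

Section flow_theory.
Context (R : realType) (phi : R -> R).
Hypothesis phi_ge0 : forall v, 1 <= v -> 0 <= phi v.
Hypothesis phi_conc : concave_on `[1, +oo[ phi.
Hypothesis phi_homo : {in `[1, +oo[ &, {homo phi : v w / v <= w}}.
Hypothesis phi1 : 0 < phi 1.
Notation Phi := (Phi phi).
Notation Phi_inv := (Phi_inv phi).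
Notation flow := (phi_flow phi).

Lemma Phi_flow (t v : R) : 0 <= t -> 1 <= v -> Phi (flow t v) = Phi v + t.
Proof. by move=> t0 v1; rewrite Phi_invK// addr_ge0// Phi_ge0. Qed.

Lemma flow0 (v : R) : 1 <= v -> flow 0 v = v.
Proof. by move=> v1; rewrite /phi_flow addr0 PhiK. Qed.

Lemma flow_ge (t v : R) : 0 <= t -> 1 <= v -> v <= flow t v.
Proof.
move=> t0 v1; apply: (Phi_le_inv phi_ge0 phi_homo phi1) => //.
  by apply: Phi_inv_ge1; rewrite // addr_ge0// Phi_ge0.
by rewrite Phi_flow// lerDl.
Qed.

Lemma flow_le (t v w : R) : 0 <= t -> 1 <= v -> v <= w -> flow t v <= flow t w.
Proof.
move=> t0 v1 vw; apply: Phi_inv_le => //; first by rewrite addr_ge0// Phi_ge0.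
by rewrite lerD2r Phi_le.
Qed.

Let sub (v w : R) := @Phi_sub R phi phi_ge0 phi_homo phi1 v w.
Let pos (v : R) := @phi_gt0 R phi phi_homo phi1 v.
Let mono (v w : R) := @phi_le R phi phi_homo v w.

Section tangent.
Variables a v : R.
Hypotheses (v1 : 1 <= v) (va : v <= a).
Let c := phi a / phi v.

Let a1 : 1 <= a. Proof. exact: le_trans va. Qed.
Let c1 : 1 <= c. Proof. by rewrite ler_pdivlMr ?pos// mul1r mono. Qed.
Let c0 : 0 <= c. Proof. exact: le_trans c1. Qed.
Let cE : c * phi v = phi a. Proof. by rewrite /c divfK// gt_eqF// pos. Qed.

(** When a = flow t v, [c] is the slope of the flow at v. The difference Phi (a + c s) - Phi (v + s)
    is nondecreasing in s: its derivative c / phi (a + c s) - 1 / phi (v + s) is nonnegative,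
    because concavity and c phi v = phi a give phi (a + c s) <= c phi (v + s). Small increments
    replace the derivative. *)
Lemma Phi_tangent_right (s : R) : 0 <= s ->
  Phi a - Phi v <= Phi (a + c * s) - Phi (v + s).
Proof.
move=> s0.
have phi_c r : 0 <= r -> phi (a + c * r) <= c * phi (v + r).
  rewrite le_eqVlt => /predU1P[<-|r0]; first by rewrite mulr0 !addr0 cE.
  have vr : v < v + r by rewrite ltrDl.
  have ar : a < a + c * r by rewrite ltrDl mulr_gt0// (lt_le_trans ltr01).
  have vrar : v + r <= a + c * r by rewrite lerD// ler_peMl// ltW.
  have := concave_on_slopes phi_conc v1 vr ar va vrar.
  rewrite [v + r]addrC addrK [a + c * r]addrC addrK [in X in _ <= X]mulrA ler_pM2r//.
  by move=> h; have := cE; lra.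
have := @homo_of_small_increments R (fun r => Phi (a + c * r) - Phi (v + r))
  (fun r => (phi (v + r))^-1) 0 s s0.
rewrite mulr0 !addr0; apply => r r' r0 rr' rs.
have r'0 := le_trans r0 rr'.
have crr : a + c * r <= a + c * r' by rewrite lerD2l ler_wpM2l.
have ar1 : 1 <= a + c * r by rewrite (le_trans a1)// lerDl mulr_ge0.
have vr1 : 1 <= v + r by rewrite (le_trans v1)// lerDl.
have vrr : v + r <= v + r' by rewrite lerD2l.
have /andP[lb _] := sub ar1 crr.
have /andP[_ ub] := sub vr1 vrr.
have : (r' - r) / phi (v + r') <= (a + c * r' - (a + c * r)) / phi (a + c * r').
  have -> : a + c * r' - (a + c * r) = c * (r' - r) by ring.
  rewrite -mulrA mulrCA ler_wpM2l ?subr_ge0//.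
  rewrite ler_pdivlMr ?pos ?(le_trans ar1)// mulrC.
  by rewrite ler_pdivrMr ?pos ?(le_trans vr1)//; exact: phi_c.
move: ub; have -> : v + r' - (v + r) = r' - r by ring.
move: lb; rewrite mulrBr; lra.
Qed.

(** The same monotonicity, moving left from v. The tangent line must also be shown to stay above the
    diagonal, so that [phi] is evaluated only on [1, +oo[. *)
Lemma Phi_tangent_left (s : R) : 0 <= s -> 1 <= v - s ->
  v - s <= a - c * s /\
  Phi a - Phi v <= Phi (a - c * s) - Phi (v - s).
Proof.
move=> s0 vs1.
have cav r : 0 <= r -> r <= v - 1 -> v - r <= a - c * r.
  (* The chord of [phi] over [v, a] is no steeper than the one over [1, v], whose slope is below phi
     v / (v - 1) as phi 1 > 0; hence (c - 1) (v - 1) <= a - v. *)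
  move=> r0 rv; suff : (c - 1) * r <= a - v by lra.
  apply: (@le_trans _ _ ((c - 1) * (v - 1))).
    by rewrite ler_wpM2l// subr_ge0.
  have [->|nv] := eqVneq v 1; first by rewrite subrr mulr0 subr_ge0 -?(eqP nv).
  have [av|nav] := eqVneq a v.
    by rewrite /c av divff ?gt_eqF ?pos// !subrr mul0r.
  have lt1v : 1 < v by rewrite lt_neqAle eq_sym nv.
  have ltva : v < a by rewrite lt_neqAle eq_sym nav.
  have := concave_on_slopes phi_conc (lexx 1) lt1v ltva v1 va.
  rewrite -cE => h.
  rewrite -(ler_pM2r (pos v1)).
  have := mulr_ge0 (ltW phi1) (ltW (_ : 0 < a - v)); rewrite subr_gt0 => /(_ ltva).
  lra.
have phi_c r : 0 <= r -> r <= v - 1 -> c * phi (v - r) <= phi (a - c * r).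
  rewrite le_eqVlt => /predU1P[<-|r0 rv]; first by rewrite mulr0 !subr0 cE.
  have vr : v - r < v by rewrite ltrBlDr ltrDl.
  have ar : a - c * r < a.
    by rewrite ltrBlDr ltrDl mulr_gt0// (lt_le_trans ltr01).
  have vr1 : 1 <= v - r by lra.
  have := concave_on_slopes phi_conc vr1 vr ar (cav _ (ltW r0) rv) va.
  rewrite !subKr [in X in _ <= X]mulrA ler_pM2r//.
  by move=> h; have := cE; lra.
split; first by apply: cav => //; lra.
have := @homo_of_small_increments R (fun r => Phi (a - c * r) - Phi (v - r))
  (fun r => - (phi (v - r))^-1) 0 s s0.
rewrite mulr0 !subr0; apply => r r' r0 rr' rs.
have r'0 := le_trans r0 rr'.
have r'v : r' <= v - 1 by lra.
have crr : a - c * r' <= a - c * r by rewrite lerD2l lerN2 ler_wpM2l.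
have vr1 : 1 <= v - r' by lra.
have ar1 : 1 <= a - c * r' by apply: le_trans vr1 _; exact: cav.
have vrr : v - r' <= v - r by rewrite lerD2l lerN2.
have /andP[_ ub] := sub ar1 crr.
have /andP[lb _] := sub vr1 vrr.
have : (a - c * r - (a - c * r')) / phi (a - c * r') <= (r' - r) / phi (v - r').
  have -> : a - c * r - (a - c * r') = c * (r' - r) by ring.
  rewrite -mulrA mulrCA ler_wpM2l ?subr_ge0//.
  rewrite ler_pdivrMr ?pos// mulrC ler_pdivlMr ?pos//.
  by apply: phi_c => //; exact: r'v.
move: lb; have -> : v - r - (v - r') = r' - r by ring.
move: ub; rewrite mulrBr !mulrN; lra.
Qed.

End tangent.

(** Concavity of the flow in its starting point: the point of the tangent line above w has a [Phi]
    value of at least Phi w + t, by one of the two preceding lemmas according to the side of v. *)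
Lemma flow_tangent (t v w : R) : 0 <= t -> 1 <= v -> 1 <= w ->
  flow t w <= flow t v + phi (flow t v) / phi v * (w - v).
Proof.
move=> t0 v1 w1; have va := flow_ge t0 v1.
have aE := Phi_flow t0 v1.
set a := flow t v in va aE *; set c := phi a / phi v.
have a1 := le_trans v1 va.
suff [b1] : 1 <= a + c * (w - v) /\
    Phi a - Phi v <= Phi (a + c * (w - v)) - Phi w.
  move=> h; rewrite /phi_flow -[leRHS](PhiK phi_ge0 phi_homo phi1)//.
  apply: Phi_inv_le => //; first by rewrite addr_ge0// Phi_ge0.
  by move: h; rewrite aE; lra.
have [vw|/ltW wv] := leP v w.
  have wv0 : 0 <= w - v by rewrite subr_ge0.
  have := Phi_tangent_right v1 va wv0; rewrite -/c [v + _]addrC subrK.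
  split=> //; rewrite (le_trans a1)// lerDl mulr_ge0// divr_ge0 ?phi_ge0//.
have vw0 : 0 <= v - w by rewrite subr_ge0.
have [] := Phi_tangent_left v1 va vw0; first by rewrite subKr.
rewrite subKr -/c -mulrN opprB => h1 h2; split=> //; exact: le_trans h1.
Qed.

(** Going back from v to v - phi v lowers [Phi] by at least 1. Hence the tangent of flow (t + 1) at
    v - phi v is an affine majorant with value at most flow t v there, and the drift condition makes
    the mean of its linear term nonpositive. *)
Lemma flow_drift (t v : R) : 0 <= t -> 1 <= v -> 1 <= v - phi v ->
  exists2 c, 0 <= c &
    forall w, 1 <= w -> flow (t + 1) w <= flow t v + c * (w - (v - phi v)).
Proof.
move=> t0 v1; set v' := v - phi v => v'1.
have vv : v' <= v by rewrite gerBl phi_ge0.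
have t1 : 0 <= t + 1 by rewrite addr_ge0.
have shift : flow (t + 1) v' <= flow t v.
  apply: Phi_inv_le => //; first by rewrite addr_ge0// Phi_ge0.
  suff : Phi v' + 1 <= Phi v by lra.
  have /andP[+ _] := sub v'1 vv.
  by rewrite /v' subKr divff ?gt_eqF ?pos//; lra.
exists (phi (flow (t + 1) v') / phi v').
  rewrite divr_ge0 ?phi_ge0//; exact: le_trans (flow_ge t1 v'1).
move=> w w1; apply: le_trans (flow_tangent t1 v'1 w1) _.
by rewrite lerD2r.
Qed.

End flow_theory.

(** * Supermartingales along a Markov chain *)

Section ge0_measurable_fun_ind.
Context (d : measure_display) (T : measurableType d) (R : realType).
Variable Q : (T -> \bar R) -> Prop.
Local Open Scope ereal_scope.
Hypothesis Q_indic : forall A, measurable A -> Q (fun x => (\1_A x)%:E).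
Hypothesis Q_scale : forall (c : R) (h : T -> \bar R), (0 <= c)%R ->
  measurable_fun setT h -> (forall x, 0 <= h x) -> Q h -> Q (fun x => c%:E * h x).
Hypothesis Q_add : forall h1 h2 : T -> \bar R,
  measurable_fun setT h1 -> (forall x, 0 <= h1 x) ->
  measurable_fun setT h2 -> (forall x, 0 <= h2 x) ->
  Q h1 -> Q h2 -> Q (fun x => h1 x + h2 x).
Hypothesis Q_lim : forall h : nat -> T -> \bar R,
  (forall n, measurable_fun setT (h n)) -> (forall n x, 0 <= h n x) ->
  (forall x, {homo h^~ x : n m / (n <= m)%N >-> n <= m}) ->
  (forall n, Q (h n)) -> Q (fun x => limn (h^~ x)).

Import HBNNSimple.

(** Simple functions are finite combinations of indicators, and every nonnegative measurable
    function is an increasing limit of simple ones. *)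
Lemma ge0_measurable_fun_ind (h : T -> \bar R) :
  measurable_fun setT h -> (forall x, 0 <= h x) -> Q h.
Proof.
move=> mh h0.
have Q_sfun (s : {nnsfun T >-> R}) : Q (fun x => (s x)%:E).
  have mterm (y : R) : measurable_fun setT
      (fun x => y%:E * (\1_(s @^-1` [set y]) x)%:E).
    apply: measurable_funeM; apply/measurable_EFinP.
    exact: measurable_indic.
  have key (r : seq R) : (forall y, y \in r -> (0 <= y)%R) ->
     Q (fun x => \sum_(y <- r) (y%:E * (\1_(s @^-1` [set y]) x)%:E)).
    elim: r => [|y r IH] r0.
      have : Q (fun x => (\1_set0 x : R)%:E) by exact: Q_indic.
      by congr Q; apply/funext => x; rewrite big_nil indicE in_set0.
    under eq_fun do rewrite big_cons.
    have y0 : (0 <= y)%R by apply: r0; rewrite mem_head.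
    apply: Q_add.
    - exact: mterm.
    - by move=> x; rewrite mule_ge0 ?lee_fin.
    - by apply: emeasurable_sum => z _; exact: mterm.
    - move=> x; rewrite big_seq; apply: sume_ge0 => z zr.
      by rewrite mule_ge0 ?lee_fin// r0// inE zr orbT.
    - by apply: Q_scale => //; [exact/measurable_EFinP/measurable_indic|exact: Q_indic].
    - by apply: IH => z zr; apply: r0; rewrite inE zr orbT.
  have := key (finmap.enum_fset (fset_set (range s))).
  have -> : (fun x => (s x)%:E) =
      (fun x => \sum_(y <- finmap.enum_fset (fset_set (range s))) (y%:E * (\1_(s @^-1` [set y]) x)%:E)).
    apply/funext => x; rewrite fimfunE fsbig_finite//= -sumEFin.
    by apply: eq_bigr => y _; rewrite EFinM.
  apply => y; rewrite [_ \in _]in_fset_set// inE => -[x _ <-]; exact: fun_ge0.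
pose h_ := nnsfun_approx measurableT mh.
have -> : h = (fun x => limn (fun n => (h_ n x)%:E)).
  by apply/funext => x; apply/esym/cvg_lim => //; exact: cvg_nnsfun_approx.
apply: Q_lim => //.
- by move=> n; exact/measurable_EFinP.
- by move=> n x; rewrite lee_fin.
- by move=> x a b ab; rewrite lee_fin; exact/lefP/nd_nnsfun_approx.
Qed.

End ge0_measurable_fun_ind.

Section disintegration.
Context (R : realType) (d : measure_display) (T : measurableType d)
  (d' : measure_display) (S : measurableType d').
Variables (m : {measure set S -> \bar R}) (k : S -> {measure set T -> \bar R}).
Variables (D : set S) (Y : S -> T).
Hypotheses (mD : measurable D) (mY : measurable_fun setT Y).
Hypothesis mk : forall A, measurable A -> measurable_fun setT (k ^~ A).
Local Open Scope ereal_scope.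
Hypothesis kE : forall A, measurable A -> m (D `&` Y @^-1` A) = \int[m]_(s in D) k s A.

Lemma measurable_integral_kernel (h : T -> \bar R) :
  measurable_fun setT h -> (forall x, 0 <= h x) ->
  measurable_fun setT (fun s => \int[k s]_x h x).
Proof. by move=> mh h0; exact: measurable_fun_integral_kernel. Qed.

(** Indicators are the case [kE], and induction over measurable functions does the rest. It serves
    for the Markov property, with Y the next state, and for the invariance of pi, with Y the
    identity. *)
Lemma integral_disintegration (h : T -> \bar R) :
  measurable_fun setT h -> (forall x, 0 <= h x) ->
  \int[m]_(s in D) h (Y s) = \int[m]_(s in D) \int[k s]_x h x.
Proof.
have mc (g : T -> \bar R) : measurable_fun setT g -> measurable_fun D (g \o Y).
  by move=> mg; apply: measurable_funTS; exact: measurableT_comp.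
have mi (g : T -> \bar R) : measurable_fun setT g -> (forall x, 0 <= g x) ->
    measurable_fun D (fun s => \int[k s]_x g x).
  by move=> mg g0; apply: measurable_funTS; exact: measurable_integral_kernel.
move: h; apply: ge0_measurable_fun_ind.
- move=> A mA; under [RHS]eq_integral do rewrite integral_indic// setIT.
  rewrite -kE// setIC -(integral_indic m mD)//.
  by rewrite -[X in measurable X]setTI; exact: mY.
- move=> c h c0 mh h0 IH.
  rewrite ge0_integralZl ?lee_fin//; [|exact: mc].
  rewrite IH -ge0_integralZl ?lee_fin//; [|exact: mi|by move=> *; exact: integral_ge0].
  by apply: eq_integral => s _; rewrite ge0_integralZl ?lee_fin.
- move=> h1 h2 mh1 h10 mh2 h20 IH1 IH2.
  rewrite ge0_integralD//; [|exact: mc|exact: mc].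
  rewrite IH1 IH2 -ge0_integralD//; first last.
  + exact: mi.
  + by move=> *; exact: integral_ge0.
  + exact: mi.
  + by move=> *; exact: integral_ge0.
  by apply: eq_integral => s _; rewrite ge0_integralD.
- move=> h mh h0 nh IH.
  rewrite (monotone_convergence _ _ (g' := fun n s => h n (Y s)))//; last first.
    by move=> n; exact: mc.
  under eq_fun do rewrite IH.
  rewrite -(monotone_convergence _ _ (g' := fun n s => \int[k s]_x h n x))//.
  + by apply: eq_integral => s _; rewrite monotone_convergence.
  + by move=> n; exact: mi.
  + by move=> *; exact: integral_ge0.
  + by move=> s _ a b ab; apply: ge0_le_integral => // x _; exact: nh.
Qed.

End disintegration.

(** * The natural filtration *)

Section natural_filtration_theory.
Context (R : realType) (d : measure_display) (T : measurableType d)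
  (d' : measure_display) (Omega : measurableType d').
Variable X : nat -> Omega -> T.
Hypothesis mX : forall k, measurable_fun setT (X k).

(** A copy of Omega with sigma(X_0, ..., X_n) as its sigma-algebra, so that measurability with
    respect to the past is ordinary measurability on this type. *)
Definition past (n : nat) : Type :=
  g_sigma_algebraType
    (\bigcup_(k in `I_n.+1) preimage_set_system setT (X k) measurable).

HB.instance Definition _ n := Measurable.on (past n).

Lemma measurable_past (n : nat) (E : set Omega) :
  measurable (E : set (past n)) -> measurable E.
Proof.
apply: smallest_sub => //; first exact: sigma_algebra_measurable.
by move=> _ [k _] [A mA <-]; exact: mX.
Qed.

Lemma measurable_fun_past d'' (U : measurableType d'') (n : nat) (h : Omega -> U) :
  measurable_fun setT (h : past n -> U) -> measurable_fun setT h.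
Proof.
by move=> mh _ B mB; apply: (@measurable_past n); apply: mh.
Qed.

Lemma measurable_past_coord (n k : nat) : (k <= n)%N ->
  measurable_fun setT (X k : past n -> T).
Proof.
move=> kn _ B mB; apply: sub_sigma_algebra; exists k => //=.
by exists B.
Qed.

End natural_filtration_theory.

Lemma measurable_fun_nat_index (d d' : measure_display) (S : measurableType d)
    (U : measurableType d') (J : S -> nat) (u : nat -> S -> U) :
  (forall j, measurable [set s | J s = j]) ->
  (forall j, measurable_fun setT (u j)) ->
  measurable_fun setT (fun s => u (J s) s).
Proof.
move=> mJ mu _ B mB; rewrite setTI.
have -> : (fun s => u (J s) s) @^-1` B =
    \bigcup_j ([set s | J s = j] `&` (u j @^-1` B)).
  apply/seteqP; split => [s Bs|s [j _ [<-]]//].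
  by exists (J s).
apply: bigcup_measurable => j _; apply: measurableI; first exact: mJ.
by rewrite -[X in measurable X]setTI; exact: mu.
Qed.

(** The product is continuous except at 0 times infinity, so the cases of a zero factor and of a
    zero limit are treated apart. *)
Lemma ereal_nondecreasing_cvgMr (R : realType) (u : nat -> \bar R) (v : \bar R) :
  (forall n, 0 <= u n)%E -> {homo u : n m / (n <= m)%N >-> (n <= m)%E} ->
  (0 <= v)%E -> (u n * v)%E @[n --> \oo] --> (limn u * v)%E.
Proof.
move=> u0 nu v0; have cu := ereal_nondecreasing_cvgn nu.
have limE : limn u = ereal_sup (range u) by exact: cvg_lim.
have ule n : (u n <= limn u)%E by rewrite limE; apply: ereal_sup_ubound; exists n.
have [vE|v_neq0] := eqVneq v 0%E.
  by rewrite vE mule0; under eq_fun do rewrite mule0; exact: cvg_cst.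
have [lE|l_neq0] := eqVneq (limn u) 0%E.
  have uE n : u n = 0%E by apply/le_anti; rewrite u0 -lE ule.
  by rewrite lE mul0e; under eq_fun do rewrite uE mul0e; exact: cvg_cst.
apply: cvgeM; [|by rewrite limE|exact: cvg_cst].
by apply: neq0_mule_def; rewrite mule_neq0.
Qed.

(** * The Markov property and weighted supermartingales *)

Section markov.
Context (R : realType) (d : measure_display) (T : measurableType d)
  (P : R.-pker T ~> T) (mu : probability T R)
  (d' : measure_display) (Omega : measurableType d')
  (Pr : probability Omega R) (X : nat -> {RV Pr >-> T}).
Hypothesis hX : markov_chain P mu X.
Local Open Scope ereal_scope.

Let X' (k : nat) : Omega -> T := X k.
Let mX k : measurable_fun setT (X' k). Proof. exact: measurable_funPT. Qed.
Let past n := past X' n.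

Let mPX n A : measurable A -> measurable_fun setT (fun w => P (X n w) A).
Proof.
move=> mA.
apply: (measurableT_comp (f := fun x => P x A) (g := X' n)) => //.
exact: measurable_kernel.
Qed.

Lemma markov_initial (h : T -> \bar R) :
  measurable_fun setT h -> (forall x, 0 <= h x) ->
  \int[Pr]_w h (X 0%N w) = \int[mu]_x h x.
Proof.
move=> mh h0; rewrite -(ge0_integral_distribution (X 0%N))//.
by apply: eq_measure_integral => A mA _; exact: (hX.1 A mA).
Qed.

Lemma markov_past_event (n : nat) (E : set Omega) (h : T -> \bar R) :
  measurable (E : set (past n)) ->
  measurable_fun setT h -> (forall x, 0 <= h x) ->
  \int[Pr]_(w in E) h (X n.+1 w) = \int[Pr]_(w in E) \int[P (X n w)]_x h x.
Proof.
move=> mE mh h0.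
apply: (integral_disintegration (k := fun w => P (X n w)) (Y := X' n.+1)) => //.
- exact: measurable_past mE.
- by move=> A mA; exact: mPX.
- by move=> A mA; exact: (hX.2 n A E mA mE).
Qed.

(** The defining property of the chain is the case of two indicators; [markov_past_event] extends it
    in h, and the induction here, run on the type [past n], extends it in Z. *)
Lemma markov_past_weight (n : nat) (Z : Omega -> \bar R) (h : T -> \bar R) :
  measurable_fun setT (Z : past n -> \bar R) -> (forall w, 0 <= Z w) ->
  measurable_fun setT h -> (forall x, 0 <= h x) ->
  \int[Pr]_w (Z w * h (X n.+1 w)) = \int[Pr]_w (Z w * \int[P (X n w)]_x h x).
Proof.
move=> mZ Z0 mh h0.
have mh1 : measurable_fun setT (fun w => h (X n.+1 w)).
  exact: (measurableT_comp mh (mX n.+1)).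
have mh2 : measurable_fun setT (fun w => \int[P (X n w)]_x h x).
  apply: (measurable_integral_kernel (k := fun w => P (X n w))) => //.
  by move=> A mA; exact: mPX.
have h10 w : 0 <= h (X n.+1 w) by [].
have h20 w : 0 <= \int[P (X n w)]_x h x by exact: integral_ge0.
have mp (g : Omega -> \bar R) : measurable_fun setT (g : past n -> \bar R) ->
  measurable_fun setT g by exact: measurable_fun_past.
move: Z mZ Z0.
apply: (@ge0_measurable_fun_ind _ (past n) R (fun Z : past n -> \bar R =>
   \int[Pr]_w (Z w * h (X n.+1 w)) = \int[Pr]_w (Z w * \int[P (X n w)]_x h x))).
- move=> E mE; have mE' := measurable_past mX mE.
  have indicE (g : Omega -> \bar R) :
      \int[Pr]_w ((\1_E w)%:E * g w) = \int[Pr]_(w in E) g w.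
    rewrite [RHS]integral_mkcond; apply: eq_integral => w _.
    by rewrite patchE indicE; case: (w \in E); rewrite ?mul1e ?mul0e.
  by rewrite !indicE; exact: markov_past_event.
- move=> c g c0 /mp mg g0 IH.
  under eq_integral do rewrite -muleA.
  under [RHS]eq_integral do rewrite -muleA.
  rewrite ge0_integralZl ?lee_fin//; [|exact: emeasurable_funM|by move=> w _; exact: mule_ge0].
  rewrite ge0_integralZl ?lee_fin//; [|exact: emeasurable_funM|by move=> w _; exact: mule_ge0].
  by rewrite IH.
- move=> g1 g2 /mp mg1 g10 /mp mg2 g20 IH1 IH2.
  under eq_integral do rewrite ge0_muleDl//.
  under [RHS]eq_integral do rewrite ge0_muleDl//.
  rewrite ge0_integralD//; first last;
    [exact: emeasurable_funM|by move=> w _; exact: mule_ge0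
    |exact: emeasurable_funM|by move=> w _; exact: mule_ge0|].
  rewrite ge0_integralD//; first last;
    [exact: emeasurable_funM|by move=> w _; exact: mule_ge0
    |exact: emeasurable_funM|by move=> w _; exact: mule_ge0|].
  by rewrite IH1 IH2.
- move=> g mg g0 ng IH.
  have lim_mul (v : Omega -> \bar R) : measurable_fun setT v -> (forall w, 0 <= v w) ->
      \int[Pr]_w (limn (g^~ w) * v w) = limn (fun n => \int[Pr]_w (g n w * v w)).
    move=> mv v0; rewrite -monotone_convergence//.
    + apply: eq_integral => w _; apply/esym/cvg_lim => //.
      by apply: ereal_nondecreasing_cvgMr => // a b; exact: ng.
    + by move=> j; apply: emeasurable_funM => //; exact: (mp _ (mg j)).
    + by move=> j w _; exact: mule_ge0.
    + by move=> w _ a b ab; rewrite lee_wpmul2r//; exact: ng.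
  by rewrite !lim_mul//; congr (limn _); apply/funext => j; exact: IH.
Qed.

(** The function applied to the next state may depend on the past through a counter J. As J is
    bounded, the integrand is a finite sum over its values, each summand being a weight times a
    fixed function. *)
Lemma markov_memory_step (n N : nat) (Z : Omega -> R) (J : Omega -> nat)
    (h : nat -> T -> \bar R) :
  measurable_fun setT (Z : past n -> R) -> (forall w, 0 <= Z w)%R ->
  (forall j, measurable ([set w | J w = j] : set (past n))) ->
  (forall w, J w < N)%N ->
  (forall j, measurable_fun setT (h j)) -> (forall j x, 0 <= h j x) ->
  \int[Pr]_w ((Z w)%:E * h (J w) (X n.+1 w)) =
  \int[Pr]_w ((Z w)%:E * \int[P (X n w)]_x h (J w) x).
Proof.
move=> mZ Z0 mJ JN mh h0.
pose Zj j w : \bar R := (Z w * \1_[set w | J w = j] w)%:E.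
have mZj j : measurable_fun setT (Zj j : past n -> \bar R).
  apply/measurable_EFinP; apply: measurable_funM => //; exact: measurable_indic.
have Zj0 j w : 0 <= Zj j w by rewrite lee_fin mulr_ge0.
have decomp (u : nat -> Omega -> \bar R) w :
    (Z w)%:E * u (J w) w = \sum_(j < N) Zj j w * u j w.
  rewrite (bigD1 (Ordinal (JN w)))//= big1 ?adde0.
    by rewrite /Zj indicE mem_set// mulr1.
  move=> j jJ; rewrite /Zj indicE memNset ?mulr0 ?mul0e//= => JE.
  by move/eqP: jJ; apply; apply: val_inj.
have mhX j : measurable_fun setT (fun w => h j (X n.+1 w)).
  exact: (measurableT_comp (mh j) (mX n.+1)).
have mPh j : measurable_fun setT (fun w => \int[P (X n w)]_x h j x).
  apply: (measurable_integral_kernel (k := fun w => P (X n w))) => //.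
  by move=> A mA; exact: mPX.
have mZj' j : measurable_fun setT (Zj j) by exact: measurable_fun_past (mZj j).
under eq_integral do rewrite (decomp (fun j w => h j (X n.+1 w))).
under [RHS]eq_integral do rewrite (decomp (fun j w => \int[P (X n w)]_x h j x)).
rewrite !ge0_integral_sum//.
- by apply: eq_bigr => j _; apply: markov_past_weight.
- by move=> j; exact: emeasurable_funM.
- by move=> j w _; apply: mule_ge0 => //; exact: integral_ge0.
- by move=> j; exact: emeasurable_funM.
- by move=> j w _; exact: mule_ge0.
Qed.

Section supermartingale.
Variables (upd : nat -> T -> nat) (j0 : nat) (zeta : T -> R).
Hypotheses (upd_le : forall j x, (upd j x <= j.+1)%N)
  (mupd : forall i j, measurable [set x | upd j x = i])
  (mzeta : measurable_fun setT zeta) (zeta0 : forall x, (0 <= zeta x)%R).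

(** A counter run alongside the chain. Its value at time k is determined by X_0, ..., X_(k-1), as is
    [weight k], so both are known one step ahead. *)
Fixpoint memory (k : nat) (w : Omega) : nat :=
  if k is k'.+1 then upd (memory k' w) (X k' w) else j0.

Definition weight (k : nat) (w : Omega) : R := \prod_(i < k) zeta (X i w).

Lemma memory_lt (k : nat) (w : Omega) : (memory k w < (j0 + k).+1)%N.
Proof.
elim: k => [|k IH] /=; first by rewrite addn0.
by rewrite ltnS addnS; apply: leq_trans (upd_le _ _) _.
Qed.

Lemma measurable_memory (n k j : nat) : (k <= n.+1)%N ->
  measurable ([set w | memory k w = j] : set (past n)).
Proof.
elim: k j => [|k IH] j kn /=.
  have [->|/eqP j0j] := eqVneq j0 j.
    have -> : [set _ : Omega | j = j] = setT by exact/seteqP.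
    exact: (@measurableT _ (past n)).
  have -> : [set _ : Omega | j0 = j] = set0 by apply/seteqP; split.
  exact: (@measurable0 _ (past n)).
have -> : [set w | upd (memory k w) (X k w) = j] =
    \bigcup_i ([set w | memory k w = i] `&` (X' k @^-1` [set x | upd i x = j])).
  by apply/seteqP; split => [w /= wj|w [i _ [/= <-]]//]; exists (memory k w).
apply: bigcup_measurable => i _; apply: measurableI.
  by apply: IH; exact: ltnW.
rewrite -[X in measurable X]setTI; apply: measurable_past_coord => //.
Qed.

Lemma weight_ge0 (k : nat) (w : Omega) : (0 <= weight k w)%R.
Proof. by apply: prodr_ge0 => i _. Qed.

Lemma measurable_weight (n k : nat) : (k <= n.+1)%N ->
  measurable_fun setT (weight k : past n -> R).
Proof.
move=> kn; rewrite /weight; apply: measurable_prod => i _.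
apply: (measurableT_comp mzeta); apply: measurable_past_coord.
by rewrite -ltnS (leq_trans (ltn_ord i)).
Qed.

Variables (n : nat) (H : nat -> nat -> T -> \bar R).
Hypotheses (mH : forall k j, measurable_fun setT (H k j))
  (H0 : forall k j x, 0 <= H k j x).
Hypothesis H_step : forall k j x, (k < n)%N ->
  (zeta x)%:E * \int[P x]_y H k.+1 (upd j x) y <= H k j x.

(** Under [H_step] the process weight k * H k (memory k) (X k) is a supermartingale, [zeta] acting
    as a multiplicative weight; comparing expectations from each step to the next suffices. *)
Lemma supermartingale :
  \int[Pr]_w ((weight n w)%:E * H n (memory n w) (X n w)) <=
  \int[mu]_x H 0%N j0 x.
Proof.
have mJ k j : measurable [set w | memory k w = j].
  by apply: (measurable_past mX (n := k)); exact: measurable_memory.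
have mZ k : measurable_fun setT (weight k).
  by apply: (measurable_fun_past mX (n := k)); exact: measurable_weight.
have mHX k i : measurable_fun setT (fun w => H k i (X k w)).
  exact: (measurableT_comp (mH k i) (mX k)).
have mPH k i : measurable_fun setT (fun w => \int[P (X k w)]_x H k.+1 i x).
  apply: (measurable_integral_kernel (k := fun w => P (X k w))) => //.
  by move=> A mA; exact: mPX.
rewrite -markov_initial//.
suff : forall k, (k <= n)%N ->
    \int[Pr]_w ((weight k w)%:E * H k (memory k w) (X k w)) <=
    \int[Pr]_w H 0%N j0 (X 0%N w) by exact.
elim=> [_|k IH kn].
  by under eq_integral do rewrite /weight big_ord0 mul1e.
apply: le_trans (IH (ltnW kn)).
rewrite (@markov_memory_step k (j0 + k.+1).+1)//; first last.
- by move=> w; exact: memory_lt.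
- by move=> j; exact: measurable_memory.
- by move=> w; exact: weight_ge0.
- exact: measurable_weight.
apply: ge0_le_integral => //.
- by move=> w _; rewrite mule_ge0 ?lee_fin ?weight_ge0// integral_ge0.
- apply: emeasurable_funM; first exact/measurable_EFinP.
  exact: (measurable_fun_nat_index (u := fun j w => \int[P (X k w)]_x H k.+1 j x)).
- apply: emeasurable_funM; first exact/measurable_EFinP.
  exact: (measurable_fun_nat_index (u := fun j w => H k j (X k w))).
- move=> w _; rewrite /weight big_ord_recr/= EFinM -muleA.
  by apply: lee_wpmul2l; [rewrite lee_fin; exact: weight_ge0|exact: H_step].
Qed.

End supermartingale.

End markov.

(** * Poisson's equation *)

Lemma bounded_integrable (R : realType) (d : measure_display) (T : measurableType d)
    (m : {measure set T -> \bar R}) (g : T -> R) (M : R) : m setT = 1%E ->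
  measurable_fun setT g -> (forall x, `|g x| <= M) -> m.-integrable setT (EFin \o g).
Proof.
move=> m1 mg gM; apply: measurable_bounded_integrable => //.
  by rewrite [X in (X < _)%E](_ : _ = m setT)// m1 ltry.
by exists M; split; [exact: num_real|move=> M' /ltW MM' x _ /=; exact: le_trans MM'].
Qed.

Lemma integrableD_EFin (R : realType) (d : measure_display) (T : measurableType d)
    (m : {measure set T -> \bar R}) (g1 g2 : T -> R) :
  m.-integrable setT (EFin \o g1) -> m.-integrable setT (EFin \o g2) ->
  m.-integrable setT (EFin \o (fun x => g1 x + g2 x)).
Proof. by move=> i1 i2; have := integrableD measurableT i1 i2. Qed.

Lemma integrableB_EFin (R : realType) (d : measure_display) (T : measurableType d)
    (m : {measure set T -> \bar R}) (g1 g2 : T -> R) :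
  m.-integrable setT (EFin \o g1) -> m.-integrable setT (EFin \o g2) ->
  m.-integrable setT (EFin \o (fun x => g1 x - g2 x)).
Proof. by move=> i1 i2; have := integrableB measurableT i1 i2. Qed.

Lemma integrableZl_EFin (R : realType) (d : measure_display) (T : measurableType d)
    (m : {measure set T -> \bar R}) (a : R) (g : T -> R) :
  m.-integrable setT (EFin \o g) -> m.-integrable setT (EFin \o (fun x => a * g x)).
Proof. by move=> ig; have := integrableZl measurableT a ig. Qed.

Lemma dominated_integrable (R : realType) (d : measure_display) (T : measurableType d)
    (m : {measure set T -> \bar R}) (g W : T -> R) :
  m.-integrable setT (EFin \o W) -> measurable_fun setT g ->
  (forall x, `|g x| <= W x) -> m.-integrable setT (EFin \o g).
Proof.
move=> iW mg gW; apply: (le_integrable measurableT _ _ iW).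
  exact/measurable_EFinP.
by move=> x _ /=; rewrite lee_fin (le_trans (gW x))// ler_norm.
Qed.

Lemma cvg_Rintegral_dominated (R : realType) (d : measure_display)
    (T : measurableType d) (m : {measure set T -> \bar R}) (u : nat -> T -> R) (v W : T -> R) :
  m.-integrable setT (EFin \o W) -> (forall n, measurable_fun setT (u n)) ->
  measurable_fun setT v -> (forall n x, `|u n x| <= W x) ->
  (forall x, u n x @[n --> \oo] --> v x) ->
  (\int[m]_x u n x) @[n --> \oo] --> \int[m]_x v x.
Proof.
move=> iW mu mv uW uv.
have [|||||iv _ cv] := @dominated_convergence _ _ _ m setT measurableT
  (fun n => EFin \o u n) (EFin \o v) (EFin \o W).
- by move=> n; exact/measurable_EFinP.
- exact/measurable_EFinP.
- by apply: aeW => x _; apply/fine_cvgP; split => //=; [exact: nearW|exact: uv].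
- exact: iW.
- by apply: aeW => x n _ /=; rewrite lee_fin.
rewrite /Rintegral; apply: fine_cvg; rewrite fineK//.
exact: integrable_fin_num.
Qed.

Section poisson.
Context (R : realType) (d : measure_display) (T : measurableType d)
  (P : R.-pker T ~> T) (pi nu : probability T R) (C : set T) (eps : R).
Hypotheses (mC : measurable C) (eps0 : 0 <= eps).
Hypothesis minor : forall x A, C x -> measurable A -> (eps%:E * nu A <= P x A)%E.
Hypothesis pi_inv : forall A, measurable A -> (\int[pi]_x P x A = pi A)%E.
Variable W : T -> R.
Hypotheses (mW : measurable_fun setT W) (W0 : forall x, 0 <= W x).
Hypotheses (iWP : forall x, (P x).-integrable setT (EFin \o W))
  (iWnu : nu.-integrable setT (EFin \o W)).

(* The kernel P killed at the regenerations which the minorization provides. *)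
Definition killed (g : T -> R) (x : T) : R :=
  \int[P x]_y g y - eps * \1_C x * \int[nu]_y g y.

Hypothesis W_drift : forall x, killed W x <= W x - 1.

Let P1 (x : T) : P x setT = 1%E. Proof. exact: prob_kernel. Qed.
Let pi1 : pi setT = 1%E. Proof. exact: probability_setT. Qed.
Let nu1 : nu setT = 1%E. Proof. exact: probability_setT. Qed.

Lemma measurable_Rintegral_kernel (g : T -> R) : measurable_fun setT g ->
  (forall x, 0 <= g x) -> measurable_fun setT (fun x => \int[P x]_y g y).
Proof.
move=> mg g0; apply: (measurableT_comp (f := fine)) => //.
apply: measurable_integral_kernel => //.
- by move=> A mA; exact: measurable_kernel.
exact/measurable_EFinP.
Qed.

Lemma measurable_killed (g : T -> R) : measurable_fun setT g ->
  (forall x, 0 <= g x) -> measurable_fun setT (killed g).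
Proof.
move=> mg g0; apply: measurable_funB; first exact: measurable_Rintegral_kernel.
apply: measurable_funM => //; apply: measurable_funM => //; exact: measurable_indic.
Qed.

Lemma minorization_integral (x : T) (g : T -> R) : C x ->
  measurable_fun setT g -> (forall y, 0 <= g y) ->
  (eps%:E * \int[nu]_y (g y)%:E <= \int[P x]_y (g y)%:E)%E.
Proof.
move=> Cx mg g0.
have := @ge0_integral_mscale _ T R nu setT measurableT (NngNum eps0) (EFin \o g).
rewrite /= => <-//; first last.
- by move=> y _; rewrite lee_fin.
- exact/measurable_EFinP.
apply: ge0_le_measure_integral => //.
- by move=> S mS; exact: minor.
- exact/measurable_EFinP.
Qed.

(** The minorization is exactly what makes P - eps 1_C nu a positive kernel. *)
Lemma killed_ge0 (g : T -> R) (x : T) : measurable_fun setT g ->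
  (forall y, 0 <= g y) -> (P x).-integrable setT (EFin \o g) ->
  nu.-integrable setT (EFin \o g) -> 0 <= killed g x.
Proof.
move=> mg g0 iP inu; rewrite /killed subr_ge0 indicE.
have [xC|xC] := boolP (x \in C); last first.
  by rewrite mulr0 mul0r; apply: Rintegral_ge0 => y _.
rewrite mulr1 -lee_fin EFinM /Rintegral fineK ?integrable_fin_num//.
rewrite fineK ?integrable_fin_num//.
exact: (minorization_integral (set_mem xC)).
Qed.

Lemma killedB (g1 g2 : T -> R) (x : T) :
  (P x).-integrable setT (EFin \o g1) -> nu.-integrable setT (EFin \o g1) ->
  (P x).-integrable setT (EFin \o g2) -> nu.-integrable setT (EFin \o g2) ->
  killed (fun y => g1 y - g2 y) x = killed g1 x - killed g2 x.
Proof. by move=> *; rewrite /killed !RintegralB//; ring. Qed.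

Lemma killed_le (g : T -> R) (x : T) (M : R) : measurable_fun setT g ->
  (forall y, 0 <= g y <= M) -> killed g x <= M.
Proof.
move=> mg gM.
have gM' y : `|g y| <= M by have /andP[g0 ?] := gM y; rewrite ger0_norm.
have iP := @bounded_integrable _ _ _ (P x) _ _ (P1 x) mg gM'.
have icst : (P x).-integrable setT (EFin \o (fun _ : T => M)).
  by apply: (@bounded_integrable _ _ _ _ _ `|M|).
apply: (@le_trans _ _ (\int[P x]_y g y)).
  rewrite /killed gerBl mulr_ge0 ?mulr_ge0//.
  by apply: Rintegral_ge0 => y _; case/andP: (gM y).
apply: (@le_trans _ _ (\int[P x]_y M)).
  by apply: le_Rintegral => // y _; case/andP: (gM y).
by rewrite Rintegral_cst//= P1/= mulr1.
Qed.

Section iteration.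
Variables (h : T -> R) (c : R).
Hypotheses (mh : measurable_fun setT h) (hc : forall x, 0 <= h x <= c).

(** The partial sums of h + R h + R^2 h + ... for the kernel R given by [killed]. *)
Fixpoint killed_sum (n : nat) : T -> R :=
  if n is n'.+1 then fun x => h x + killed (killed_sum n') x else cst 0.
Notation u := killed_sum.

Let c0 : 0 <= c. Proof. by have /andP[h0 h1] := hc point; exact: le_trans h0 h1. Qed.

Let icW (m : {measure set T -> \bar R}) : m.-integrable setT (EFin \o W) ->
  m.-integrable setT (EFin \o (fun x => c * W x)).
Proof. exact: integrableZl_EFin. Qed.

(** The bound c n gives integrability under every probability, pi included. The bound c W is uniform
    in n: by [W_drift], c W is a supersolution, and positivity of R on c W - u n carries the bound
    over. *)
Let u_props n : [/\ measurable_fun setT (u n), forall x, 0 <= u n x,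
  forall x, u n x <= c * n%:R & forall x, u n x <= c * W x].
Proof.
elim: n => [|n [mu u0 un uW]] /=.
  by split=> // x; rewrite ?mulr0// mulr_ge0.
have hx0 x : 0 <= h x by case/andP: (hc x).
have hxc x : h x <= c by case/andP: (hc x).
have uW' x : `|u n x| <= c * W x by rewrite ger0_norm.
have iu (m : {measure set T -> \bar R}) : m.-integrable setT (EFin \o W) ->
    m.-integrable setT (EFin \o u n).
  by move=> iW; exact: dominated_integrable (icW iW) mu uW'.
split.
- by apply: measurable_funD => //; exact: measurable_killed.
- by move=> x; rewrite addr_ge0// killed_ge0//; [exact: iu|exact: iu].
- move=> x; rewrite -natr1 mulrDr mulr1 addrC lerD// killed_le// => y.
  by rewrite u0 un.
- move=> x; have : 0 <= killed (fun y => c * W y - u n y) x.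
    apply: killed_ge0.
    + by apply: measurable_funB => //; exact: measurable_funM.
    + by move=> y; rewrite subr_ge0.
    + by apply: integrableB_EFin; [exact: icW|exact: iu].
    + by apply: integrableB_EFin; [exact: icW|exact: iu].
  rewrite killedB//; [|exact: icW|exact: icW
    |exact: iu|exact: iu].
  have -> : killed (fun y => c * W y) x = c * killed W x.
    by rewrite /killed !RintegralZl//; ring.
  have := ler_wpM2l c0 (W_drift x); have := hxc x; lra.
Qed.

Let mu n : measurable_fun setT (u n). Proof. by case: (u_props n). Qed.
Let u0 n x : 0 <= u n x. Proof. by case: (u_props n). Qed.
Let un n x : u n x <= c * n%:R. Proof. by case: (u_props n). Qed.
Let uW n x : u n x <= c * W x. Proof. by case: (u_props n). Qed.

Let iu (m : {measure set T -> \bar R}) n : m setT = 1%E -> m.-integrable setT (EFin \o u n).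
Proof. by move=> m1; apply: (@bounded_integrable _ _ _ _ _ (c * n%:R)) => // x; rewrite ger0_norm. Qed.

(** The increment is R^n h, and R is positive with total mass at most 1. *)
Let u_incr n x : 0 <= u n.+1 x - u n x <= c.
Proof.
elim: n x => [x|n IH x].
  rewrite /= /killed !(Rintegral_cst _ measurableT) !mul0r mulr0 !subr0 addr0.
  exact: hc.
have -> : u n.+2 x - u n.+1 x = killed (fun y => u n.+1 y - u n y) x.
  by rewrite killedB ?iu//=; ring.
have mD : measurable_fun setT (fun y => u n.+1 y - u n y) by exact: measurable_funB.
have D0 y : 0 <= u n.+1 y - u n y by case/andP: (IH y).
have iD (m : {measure set T -> \bar R}) : m setT = 1%E ->
    m.-integrable setT (EFin \o (fun y => u n.+1 y - u n y)).
  by move=> m1; apply: (@bounded_integrable _ _ _ _ _ c) => // y; rewrite ger0_norm//; case/andP: (IH y).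
by rewrite killed_ge0 ?killed_le//; exact: iD.
Qed.

Let u_nd x : {homo u^~ x : n m / (n <= m)%N >-> n <= m}.
Proof.
by apply/nondecreasing_seqP => n; rewrite -subr_ge0; case/andP: (u_incr n x).
Qed.

Definition potential (x : T) : R := limn (u^~ x).
Notation v := potential.

Let u_cvg x : u n x @[n --> \oo] --> v x.
Proof.
apply: nondecreasing_is_cvgn; first exact: u_nd.
by exists (c * W x) => _ [n _ <-].
Qed.

Lemma measurable_potential : measurable_fun setT v.
Proof. by apply: (measurable_fun_cvg mu) => x _; exact: u_cvg. Qed.

Lemma potential_ge0 (x : T) : 0 <= v x.
Proof. by apply: limr_ge; [apply/cvg_ex; exists (v x); exact: u_cvg|exact: nearW]. Qed.

Lemma potential_le (x : T) : v x <= c * W x.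
Proof. by apply: limr_le; [apply/cvg_ex; exists (v x); exact: u_cvg|exact: nearW]. Qed.

Let cvg_int (m : {measure set T -> \bar R}) : m.-integrable setT (EFin \o W) ->
  (\int[m]_x u n x) @[n --> \oo] --> \int[m]_x v x.
Proof.
move=> iW; apply: (cvg_Rintegral_dominated (icW iW)) => //.
- exact: measurable_potential.
- by move=> n x; rewrite ger0_norm.
Qed.

(** The limit of the recursion; domination by c W allows it under both P x and nu. *)
Lemma potential_eq (x : T) : v x = h x + killed v x.
Proof.
have l1 : u n.+1 x @[n --> \oo] --> v x by rewrite (cvg_shiftS (fun n => u n x)); exact: u_cvg.
have l2 : u n.+1 x @[n --> \oo] --> h x + killed v x.
  apply: cvgD; first exact: cvg_cst.
  apply: cvgB; first exact: cvg_int.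
  by apply: cvgM; [exact: cvg_cst|exact: cvg_int].
exact: (cvg_unique _ l1 l2).
Qed.

Lemma Rintegral_invariant (g : T -> R) (M : R) : measurable_fun setT g ->
  (forall x, 0 <= g x <= M) -> \int[pi]_x (\int[P x]_y g y) = \int[pi]_x g x.
Proof.
move=> mg gM; rewrite /Rintegral; congr fine.
have g0 x : 0 <= g x by case/andP: (gM x).
have iP x : (P x).-integrable setT (EFin \o g).
  by apply: (@bounded_integrable _ _ _ _ _ M) => // y; rewrite ger0_norm//; case/andP: (gM y).
have := @integral_disintegration R d T d T pi P setT id measurableT.
move=> /(_ _ _ _ (EFin \o g)) /= ->//.
- by apply: eq_integral => x _; rewrite fineK//; exact: (integrable_fin_num _ (iP x)).
- by move=> A mA; exact: measurable_kernel.
- by move=> A mA; rewrite setTI preimage_id pi_inv.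
- exact/measurable_EFinP.
Qed.

(** Integrating the recursion under pi, invariance cancels pi (P u_n) against pi (u_n) and leaves pi
    (R^n h) = pi h - eps pi(C) nu (u_n). The left side tends to 0 by bounded convergence, since the
    increments lie in [0, c] and u_n converges pointwise. *)
Lemma potential_mass : eps * fine (pi C) * \int[nu]_x v x = \int[pi]_x h x.
Proof.
have ih : pi.-integrable setT (EFin \o h).
  by apply: (@bounded_integrable _ _ _ _ _ c) => // x;
    have /andP[h0 h1] := hc x; rewrite ger0_norm.
have stepE n : \int[pi]_x (u n.+1 x - u n x) =
    \int[pi]_x h x - eps * fine (pi C) * \int[nu]_x u n x.
  have un' x : 0 <= u n x <= c * n%:R by rewrite u0 un.
  have iPu : pi.-integrable setT (EFin \o (fun x => \int[P x]_y u n y)).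
    apply: (@bounded_integrable _ _ _ _ _ (c * n%:R)) => //.
      exact: measurable_Rintegral_kernel.
    move=> x; rewrite ger0_norm ?Rintegral_ge0//.
    apply: (@le_trans _ _ (\int[P x]_y (c * n%:R))).
      apply: le_Rintegral => //; first exact: iu.
      by apply: (@bounded_integrable _ _ _ (P x) _ `|c * n%:R|).
    by rewrite Rintegral_cst//= P1/= mulr1.
  have iC : pi.-integrable setT (EFin \o (\1_C : T -> R)).
    apply: (@bounded_integrable _ _ _ _ _ 1) => //.
    by move=> x; rewrite indicE; case: (_ \in _); rewrite ?normr1 ?normr0.
  pose a := eps * \int[nu]_x u n x.
  have iaC : pi.-integrable setT (EFin \o (fun x => a * \1_C x)).
    exact: integrableZl_EFin.
  have -> : \int[pi]_x (u n.+1 x - u n x) =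
      \int[pi]_x (h x + \int[P x]_y u n y - (a * \1_C x) - u n x).
    by apply: eq_Rintegral => x _; rewrite /= /killed /a; ring.
  have iD1 : pi.-integrable setT (EFin \o (fun x => h x + \int[P x]_y u n y)).
    exact: integrableD_EFin.
  have iD2 : pi.-integrable setT
      (EFin \o (fun x => h x + \int[P x]_y u n y - (a * \1_C x))).
    exact: integrableB_EFin.
  have iun := iu n pi1.
  rewrite RintegralB// RintegralB// RintegralD// RintegralZl//.
  rewrite (Rintegral_invariant (mu n) un').
  have -> : \int[pi]_x \1_C x = fine (pi C).
    by rewrite /Rintegral integral_indic// setIT.
  by rewrite /a; ring.
have l0 : (\int[pi]_x (u n.+1 x - u n x)) @[n --> \oo] --> \int[pi]_x (0 : R).
  apply: (cvg_Rintegral_dominated (W := fun=> c)) => //.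
  - by apply: (@bounded_integrable _ _ _ _ _ `|c|).
  - by move=> n; exact: measurable_funB.
  - by move=> n x; have /andP[D0 Dc] := u_incr n x; rewrite ger0_norm.
  - move=> x; rewrite -(subrr (v x)); apply: cvgB; last exact: u_cvg.
    by rewrite (cvg_shiftS (fun n => u n x)); exact: u_cvg.
have l1 : (\int[pi]_x (u n.+1 x - u n x)) @[n --> \oo] -->
    \int[pi]_x h x - eps * fine (pi C) * \int[nu]_x v x.
  under eq_fun do rewrite stepE.
  apply: cvgB; first exact: cvg_cst.
  by apply: cvgM; [exact: cvg_cst|exact: cvg_int].
have lE : \int[pi]_x (0 : R) = \int[pi]_x h x - eps * fine (pi C) * \int[nu]_x v x.
  exact: (cvg_unique _ l0 l1).
by apply/esym/subr0_eq; rewrite -lE Rintegral_cst// mul0r.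
Qed.

End iteration.

(* Apply the potential to f + F and to the constant F: both have the same
   integral under pi, so the regeneration terms in potential_eq cancel. *)
Lemma poisson_equation (f : T -> R) (F : R) : 0 < F ->
  measurable_fun setT f -> (forall x, `|f x| <= F) -> \int[pi]_x f x = 0 ->
  exists g : T -> R, [/\ measurable_fun setT g,
    forall x, `|g x| <= 2 * F * W x &
    forall x, g x = f x + \int[P x]_y g y].
Proof.
move=> F0 mf fF pif.
have fF2 x : 0 <= f x + F <= 2 * F.
  by have := fF x; rewrite ler_norml => /andP[]; lra.
have FF2 (x : T) : 0 <= F <= 2 * F by apply/andP; split; lra.
have mf' : measurable_fun setT (fun x => f x + F) by exact: measurable_funD.
have mF : measurable_fun setT (fun _ : T => F) by [].
pose v1 := potential (fun x => f x + F); pose v2 := potential (fun _ : T => F).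
have := potential_mass mf' fF2; have := potential_mass mF FF2.
rewrite -/v1 -/v2.
have if_ : pi.-integrable setT (EFin \o f) by exact: bounded_integrable pi1 mf fF.
have iF : pi.-integrable setT (EFin \o (fun _ : T => F)).
  by apply: (@bounded_integrable _ _ _ _ _ F) => // x; rewrite ger0_norm// ltW.
rewrite RintegralD// pif add0r.
rewrite Rintegral_cst//= probability_setT/= mulr1 => m2 m1.
have nuE : \int[nu]_x v1 x = \int[nu]_x v2 x.
  (* Cancelling eps pi(C) is legitimate: were it zero, [m2] would read 0 = F. *)
  apply: (@mulfI _ (eps * fine (pi C))); last by rewrite m1 m2.
  by apply/negP => /eqP e0; move: m2; rewrite e0 mul0r; move/eqP; rewrite lt_eqF.
have mv1 := measurable_potential mf' fF2; have mv2 := measurable_potential mF FF2.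
have b1 := potential_le mf' fF2; have b2 := potential_le mF FF2.
have p1 := potential_ge0 mf' fF2; have p2 := potential_ge0 mF FF2.
rewrite -/v1 -/v2 in mv1 mv2 b1 b2 p1 p2.
exists (fun x => v1 x - v2 x); split.
- exact: measurable_funB.
- move=> x; rewrite ler_norml; have := b1 x; have := b2 x; have := p1 x; have := p2 x.
  by clear FF2 => *; apply/andP; split; lra.
- move=> x.
  have iv1 : (P x).-integrable setT (EFin \o v1).
    apply: (dominated_integrable (W := fun x => 2 * F * W x)) => //.
      exact: integrableZl_EFin.
    by move=> y; rewrite ger0_norm.
  have iv2 : (P x).-integrable setT (EFin \o v2).
    apply: (dominated_integrable (W := fun x => 2 * F * W x)) => //.
      exact: integrableZl_EFin.
    by move=> y; rewrite ger0_norm.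
  rewrite RintegralB//.
  have := potential_eq mf' fF2 x; have := potential_eq mF FF2 x.
  by clear FF2; rewrite -/v1 -/v2 /killed nuE; lra.
Qed.

End poisson.

(** * Deviation bounds *)

(** Algebra of a step from C, with g standing for l g x. Of the gain l dl, half pays the cross term
    l (f - dl) g, as G s = dl / 2, and a quarter pays the restart of the flow term. *)
Lemma supersolution_regeneration (R : realFieldType) (l G dl f g s w : R) :
  0 < l -> l * G <= 1 -> G * s = dl / 2 -> 0 < dl ->
  `|f - dl| <= G -> `|g| <= s -> 0 <= w ->
  1 + (g - l * f) + l * dl / 4 <= (1 - l * (f - dl)) * (1 + g + w).
Proof.
move=> l0 lG Gs dl0 fG gs w0.
have h1 : l * ((f - dl) * g) <= l * (dl / 2).
  rewrite ler_pM2l// -Gs (le_trans (ler_norm _))// normrM.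
  by rewrite ler_pM.
have h2 : l * (f - dl) <= l * G by rewrite ler_pM2l// (le_trans (ler_norm _)).
have h3 : 0 <= (1 - l * (f - dl)) * w by rewrite mulr_ge0//; lra.
have h4 : 0 <= l * dl by rewrite mulr_ge0// ltW.
lra.
Qed.

(** Algebra of a step outside C. The cross term (f - dl) g is paid by the gain dl if |g| <= s;
    otherwise it is paid, like (f - dl) w, by the shrinking of w by the factor 1 - 2 l G. *)
Lemma supersolution_excursion (R : realFieldType) (l G dl f g s w : R) :
  0 < l -> G * s = dl / 2 -> 0 < dl -> 0 <= G ->
  `|f - dl| <= G -> `|g| <= s \/ `|g| <= w / 2 -> 0 <= w ->
  1 + (g - l * f) + (1 - 2 * (l * G)) * w <= (1 - l * (f - dl)) * (1 + g + w).
Proof.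
move=> l0 Gs dl0 G0 fG gw w0.
have h1 : (f - dl) * g <= G * `|g|.
  by rewrite (le_trans (ler_norm _))// normrM ler_wpM2r.
have h2 : (f - dl) * w <= G * w by rewrite ler_wpM2r// (le_trans (ler_norm _)).
have h3 : G * `|g| <= dl / 2 + G * (w / 2).
  have h : 0 <= G * (w / 2) by rewrite mulr_ge0// divr_ge0.
  case: gw => gw; have := ler_wpM2l G0 gw; rewrite ?Gs; lra.
have h4 : 0 <= G * w by rewrite mulr_ge0.
have h5 : (f - dl) * g + (f - dl) * w <= dl + 2 * (G * w) by lra.
have := ler_wpM2l (ltW l0) h5; lra.
Qed.

(** With x = 4 l G this bounds the decay factor of one step by the 1 - 2 l G of
    [supersolution_excursion]. *)
Lemma expRN_le (R : realType) (x : R) : 0 <= x -> x <= 1 ->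
  expR (- x) <= 1 - x / 2.
Proof.
move=> x0 x1; rewrite expRN -[leLHS]mul1r ler_pdivrMr ?expR_gt0//.
have h : 0 <= 1 - x / 2 by lra.
apply: le_trans (ler_wpM2l h (expR_ge1Dx x)).
have : 0 <= x * (1 - x) by rewrite mulr_ge0// subr_ge0.
lra.
Qed.

Lemma normr_le_enorm (R : realType) (d : nat) (v : 'rV[R]_d) (i : 'I_d) :
  `|v ord0 i| <= enorm v.
Proof.
rewrite -sqrtr_sqr /enorm ler_wsqrtr// (bigD1 i)//= lerDl.
by apply: sumr_ge0 => j _; exact: sqr_ge0.
Qed.

Lemma measurable_enorm (R : realType) (d : nat) (disp : measure_display)
    (S : measurableType disp) (v : S -> 'rV[R]_d) :
  (forall i, measurable_fun setT (fun s => v s ord0 i)) ->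
  measurable_fun setT (fun s => enorm (v s)).
Proof.
move=> mv; rewrite /enorm; apply: (measurableT_comp (f := @Num.sqrt R)).
  by apply: nondecreasing_measurable => // x y xy; exact: ler_wsqrtr.
by apply: measurable_sum => i; exact: measurable_funX.
Qed.

(** If all signed components are at most a, the norm is at most a sqrt d; the cruder factor d + 1
    can be divided by even for d = 0. The boolean of the pair encodes the sign. *)
Lemma enorm_large_component (R : realType) (d : nat) (v : 'rV[R]_d) (a : R) :
  0 <= a -> a * d.+1%:R < enorm v -> exists p : 'I_d * bool, a < (-1) ^+ p.2 * v ord0 p.1.
Proof.
move=> a0; apply: contraPP => H; apply/negP; rewrite -leNgt.
have va i : `|v ord0 i| <= a.
  by rewrite ler_norml; apply/andP; split; rewrite leNgt; apply/negP => h; apply: H;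
    [exists (i, true); rewrite /= expr1 mulN1r ltrNr|exists (i, false); rewrite /= expr0 mul1r].
have ad0 : 0 <= a * d.+1%:R by rewrite mulr_ge0.
rewrite -(ger0_norm ad0) -sqrtr_sqr /enorm ler_wsqrtr//.
apply: (@le_trans _ _ (\sum_(i < d) a ^+ 2)).
  apply: ler_sum => i _; rewrite -real_normK ?num_real//.
  by rewrite ler_sqr ?nnegrE.
rewrite sumr_const card_ord -[leLHS]mulr_natr exprMn ler_wpM2l ?sqr_ge0//.
by rewrite -natrX ler_nat (leq_trans (leqnSn d))// leq_pmulr.
Qed.

Lemma union_bound (R : realType) (d : measure_display) (T : measurableType d)
    (m : {measure set T -> \bar R}) (I : Type) (r : seq I) (E : I -> set T) (a : R) :
  (forall i, measurable (E i)) -> (forall i, (m (E i) <= a%:E)%E) ->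
  (m (\big[setU/set0]_(i <- r) E i) <= ((size r)%:R * a)%:E)%E.
Proof.
move=> mE Ea; elim: r => [|i r IH]; first by rewrite big_nil measure0 mul0r.
rewrite big_cons; apply: le_trans (measureU2 _ (mE i) _) _.
  by apply: bigsetU_measurable.
by rewrite /= -natr1 mulrDl mul1r addrC EFinD leeD.
Qed.

Lemma EFin_Rintegral (R : realType) (d : measure_display) (T : measurableType d)
    (m : {measure set T -> \bar R}) (g : T -> R) :
  m.-integrable setT (EFin \o g) -> (\int[m]_x (g x)%:E)%E = (\int[m]_x g x)%:E.
Proof. by move=> ig; rewrite /Rintegral fineK//; exact: integrable_fin_num. Qed.

Lemma ge0_integrable_lty (R : realType) (d : measure_display) (T : measurableType d)
    (m : {measure set T -> \bar R}) (g : T -> R) : measurable_fun setT g ->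
  (forall x, 0 <= g x) -> (\int[m]_x (g x)%:E < +oo)%E ->
  m.-integrable setT (EFin \o g).
Proof.
move=> mg g0 goo; apply/integrableP; split; first exact/measurable_EFinP.
by under eq_integral do rewrite /= ger0_norm//.
Qed.

(** * The drift condition for functions of V *)

Section drift.
Context (R : realType) (d : measure_display) (T : measurableType d)
  (P : R.-pker T ~> T) (pi nu mu : probability T R) (C : set T)
  (eps b vC : R) (phi : R -> R) (V : T -> R).
Hypotheses (mC : measurable C) (eps0 : 0 < eps) (nuC : nu C = 1%E).
Hypothesis minor : forall x A, C x -> measurable A -> (eps%:E * nu A <= P x A)%E.
Hypothesis pi_inv : forall A, measurable A -> (\int[pi]_x P x A = pi A)%E.
Hypothesis phi_ge0 : forall v, 1 <= v -> 0 <= phi v.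
Hypothesis phi_conc : concave_on `[1, +oo[ phi.
Hypothesis phi_homo : {in `[1, +oo[ &, {homo phi : v w / v <= w}}.
Hypothesis phi1 : 0 < phi 1.
Hypothesis phi_y : phi v @[v --> +oo] --> +oo.
Hypotheses (mV : measurable_fun setT V) (V1 : forall x, 1 <= V x).
Hypotheses (VC : forall x, C x -> V x <= vC) (b0 : 0 < b).
Hypothesis PV : forall x,
  (\int[P x]_y (V y)%:E <= (V x - phi (V x) + b * \1_C x)%:E)%E.
Hypothesis muV : (\int[mu]_x (V x)%:E < +oo)%E.
Notation Phi := (Phi phi).
Notation Phi_inv := (Phi_inv phi).
Notation flow := (phi_flow phi).

Let V0 x : 0 <= V x. Proof. exact: le_trans (V1 x). Qed.
Let P1 (x : T) : P x setT = 1%E. Proof. exact: prob_kernel. Qed.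

Lemma measurable_homo_comp (h : R -> R) :
  (forall v w, 1 <= v -> v <= w -> h v <= h w) -> measurable_fun setT (h \o V).
Proof.
move=> hh; have -> : h \o V = (fun v => h (Num.max 1 v)) \o V.
  by apply/funext => x /=; rewrite max_r.
apply: measurableT_comp => //; apply: nondecreasing_measurable => // v w vw.
apply: hh; first by rewrite le_max lexx.
by rewrite ge_max !le_max lexx vw/= orbT.
Qed.

Lemma measurable_PhiV : measurable_fun setT (Phi \o V).
Proof. by apply: measurable_homo_comp => *; exact: Phi_le. Qed.

Lemma measurable_flowV (t : R) : 0 <= t -> measurable_fun setT (flow t \o V).
Proof. by move=> t0; apply: measurable_homo_comp => *; exact: flow_le. Qed.

Lemma integrable_PV (x : T) : (P x).-integrable setT (EFin \o V).
Proof. by apply: ge0_integrable_lty => //; apply: le_lt_trans (PV x) _; rewrite ltry. Qed.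

Lemma integrable_muV : mu.-integrable setT (EFin \o V).
Proof. exact: ge0_integrable_lty. Qed.

(** At a point x of C, which is nonempty as nu C = 1, the minorization gives eps nu(V) <= PV(x) <
    +oo. *)
Lemma integrable_nuV : nu.-integrable setT (EFin \o V).
Proof.
have [x Cx] : C !=set0.
  by apply/set0P/eqP => C0; move: nuC; rewrite C0 measure0 => /eqP; rewrite eqe eq_sym oner_eq0.
apply: ge0_integrable_lty => //.
have h := le_lt_trans (minorization_integral (ltW eps0) minor Cx mV V0)
  (le_lt_trans (PV x) (ltry _)).
rewrite ltey; apply/eqP => nuoo; move: h; rewrite /= nuoo gt0_muley ?lte_fin//.
Qed.

Lemma RPV (x : T) : \int[P x]_y V y <= V x - phi (V x) + b * \1_C x.
Proof. by rewrite -lee_fin -EFin_Rintegral//; exact: integrable_PV. Qed.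

Lemma Rintegral_cst_P (x : T) (c : R) : \int[P x]_y c = c.
Proof. by rewrite Rintegral_cst// P1 mulr1. Qed.

Lemma integrable_cst_P (x : T) (c : R) : (P x).-integrable setT (EFin \o (fun _ : T => c)).
Proof. by apply: (@bounded_integrable _ _ _ _ _ `|c|). Qed.

Lemma integrable_affine (m : {measure set T -> \bar R}) (h : T -> R) (a c : R) :
  m setT = 1%E -> m.-integrable setT (EFin \o V) -> measurable_fun setT h ->
  (forall x, 0 <= h x <= a + c * V x) -> m.-integrable setT (EFin \o h).
Proof.
move=> m1 iV mh hV; apply: (@dominated_integrable _ _ _ _ _ (fun x => a + c * V x)) => //.
  apply: integrableD_EFin; last exact: integrableZl_EFin.
  by apply: (@bounded_integrable _ _ _ _ _ `|a|).
by move=> x; have /andP[h0 h1] := hV x; rewrite ger0_norm.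
Qed.

(** Jensen's inequality as used here: a concave function of V is first replaced by a tangent, which
    the drift condition then integrates. The slope is nonnegative because the drift condition bounds
    PV only from above. *)
Lemma Rintegral_le_affine (x : T) (h : T -> R) (a c : R) : 0 <= c ->
  (P x).-integrable setT (EFin \o h) ->
  (forall y, h y <= a + c * V y) ->
  \int[P x]_y h y <= a + c * (V x - phi (V x) + b * \1_C x).
Proof.
move=> c0 ih hV.
have iV := integrable_PV x.
apply: (@le_trans _ _ (\int[P x]_y (a + c * V y))).
  apply: le_Rintegral => //; apply: integrableD_EFin; first exact: integrable_cst_P.
  exact: integrableZl_EFin.
rewrite RintegralD//; [|exact: integrable_cst_P|exact: integrableZl_EFin].
by rewrite RintegralZl// Rintegral_cst_P lerD2l ler_wpM2l// RPV.
Qed.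

Lemma integrable_PhiV (m : {measure set T -> \bar R}) : m setT = 1%E ->
  m.-integrable setT (EFin \o V) -> m.-integrable setT (EFin \o (Phi \o V)).
Proof.
move=> m1 iV; apply: (@integrable_affine _ _ (- (phi 1)^-1) (phi 1)^-1) => //.
  exact: measurable_PhiV.
move=> x; rewrite /= Phi_ge0//=.
by have := Phi_tangent phi_ge0 phi_homo phi1 (lexx 1) (V1 x); rewrite Phi1; lra.
Qed.

Lemma integrable_flowV (m : {measure set T -> \bar R}) (t : R) : 0 <= t ->
  m setT = 1%E -> m.-integrable setT (EFin \o V) ->
  m.-integrable setT (EFin \o (flow t \o V)).
Proof.
move=> t0 m1 iV; pose c := phi (flow t 1) / phi 1.
apply: (@integrable_affine _ _ (flow t 1 - c) c) => //; first exact: measurable_flowV.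
move=> x /=; apply/andP; split.
  by apply: le_trans (flow_ge phi_ge0 phi_conc phi_homo phi1 t0 (V1 x)).
have := flow_tangent phi_ge0 phi_conc phi_homo phi1 t0 (lexx 1) (V1 x).
by rewrite -/c; lra.
Qed.

(** The tangent of [Phi] at V x has slope 1 / phi (V x), which turns the decrease phi (V x) into 1
    and the term b 1_C into at most b / phi 1 on C. *)
Lemma PhiV_drift (x : T) :
  \int[P x]_y Phi (V y) <= Phi (V x) - 1 + b / phi 1 * \1_C x.
Proof.
have p0 := phi_gt0 phi_homo phi1 (V1 x).
have := @Rintegral_le_affine x (Phi \o V) (Phi (V x) - V x / phi (V x))
  (phi (V x))^-1.
rewrite invr_ge0 (ltW p0) => /(_ isT).
move=> /(_ (integrable_PhiV (P1 x) (integrable_PV x))) h.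
have {}h := h _; apply: le_trans (h _) _.
  by move=> y /=; have := Phi_tangent phi_ge0 phi_homo phi1 (V1 x) (V1 y); lra.
have -> : Phi (V x) - V x / phi (V x) + (phi (V x))^-1 * (V x - phi (V x) + b * \1_C x)
   = Phi (V x) - 1 + (b * \1_C x) / phi (V x).
  by field; rewrite gt_eqF.
rewrite lerD2l mulrAC ler_wpM2r//.
by rewrite ler_wpM2l ?(ltW b0)// inv_phi_le.
Qed.

Lemma flowV_drift (x : T) (t : R) : 0 <= t -> ~ C x ->
  \int[P x]_y flow (t + 1) (V y) <= flow t (V x).
Proof.
move=> t0 Cx.
have C0 : \1_C x = 0 :> R by rewrite indicE memNset.
(* The mean of V under P x is at least 1, so outside C the point V x - phi (V x) stays in the domain
   of [Phi]. *)
have Vphi : 1 <= V x - phi (V x).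
  have := RPV x; rewrite C0 mulr0 addr0; apply: le_trans.
  rewrite -[leLHS](Rintegral_cst_P x); apply: le_Rintegral => //.
  - exact: integrable_cst_P.
  - exact: integrable_PV.
have [c c0 hc] := flow_drift phi_ge0 phi_conc phi_homo phi1 t0 (V1 x) Vphi.
have := @Rintegral_le_affine x (flow (t + 1) \o V) (flow t (V x) - c * (V x - phi (V x))) c c0.
rewrite C0 mulr0 addr0 subrK; apply.
  by apply: integrable_flowV => //; [rewrite addr_ge0|exact: integrable_PV].
by move=> y /=; have := hc _ (V1 y); lra.
Qed.

Let B : R := vC + b.

Lemma V_drift_C (x : T) : C x -> \int[P x]_y V y <= B.
Proof.
move=> Cx; apply: le_trans (RPV x) _; rewrite indicE mem_set// mulr1 /B.
by have := VC Cx; have := phi_ge0 (V1 x); lra.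
Qed.

Lemma bounded_poisson_equation (f : T -> R) (F : R) : 0 < F ->
  measurable_fun setT f -> (forall x, `|f x| <= F) -> \int[pi]_x f x = 0 ->
  exists (g : T -> R) (c : R), [/\ 0 < c, measurable_fun setT g,
    forall x, `|g x| <= c * (Phi (V x) + 1),
    forall x, (P x).-integrable setT (EFin \o g) &
    forall x, g x = f x + \int[P x]_y g y].
Proof.
move=> F0 mf fF pif.
(* Since eps a = b / phi 1, the regeneration term eps 1_C nu(W) >= eps a 1_C absorbs the positive
   term of [PhiV_drift]. *)
pose a := b / phi 1 / eps.
have a0 : 0 <= a by rewrite !divr_ge0// ltW.
pose W x := Phi (V x) + a.
have W0 x : 0 <= W x by rewrite addr_ge0// Phi_ge0.
have mW : measurable_fun setT W by apply: measurable_funD => //; exact: measurable_PhiV.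
have iW (m : {measure set T -> \bar R}) : m setT = 1%E ->
    m.-integrable setT (EFin \o V) -> m.-integrable setT (EFin \o W).
  move=> m1 iV; apply: integrableD_EFin; first exact: (integrable_PhiV m1 iV).
  by apply: (@bounded_integrable _ _ _ _ _ `|a|).
have nu1 : nu setT = 1%E by exact: probability_setT.
have killedW x : killed P nu C eps W x <= W x - 1.
  rewrite /killed /W !RintegralD//; first last;
    [exact: integrable_cst_P|exact: (integrable_PhiV (P1 x) (integrable_PV x))
    |by apply: (@bounded_integrable _ _ _ _ _ `|a|)
    |exact: (integrable_PhiV nu1 integrable_nuV)|].
  rewrite Rintegral_cst_P Rintegral_cst//= probability_setT/= mulr1.
  have nuPhi : 0 <= \int[nu]_y Phi (V y) by apply: Rintegral_ge0 => y _; rewrite Phi_ge0.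
  have := PhiV_drift x.
  have -> : b / phi 1 = eps * a by rewrite /a [RHS]mulrC divfK// gt_eqF.
  have : 0 <= eps * \1_C x * \int[nu]_y Phi (V y).
    by rewrite !mulr_ge0// ltW.
  lra.
have [g [mg gW gE]] := poisson_equation mC (ltW eps0) minor pi_inv mW W0
  (fun x => iW _ (P1 x) (integrable_PV x)) (iW _ nu1 integrable_nuV) killedW F0 mf fF pif.
exists g, (2 * F * (1 + a)); split => //.
- by rewrite !mulr_gt0// ltr_pwDl.
- move=> x; apply: le_trans (gW x) _; rewrite -[leRHS]mulrA ler_wpM2l ?mulr_ge0 ?(ltW F0)//.
  rewrite /W; have := Phi_ge0 phi_ge0 phi_homo phi1 (V1 x); nra.
- move=> x; apply: (@dominated_integrable _ _ _ _ _ (fun y => 2 * F * W y)) => //.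
  by apply: integrableZl_EFin; exact: iW (P1 x) (integrable_PV x).
Qed.

Lemma return_bound_gt0 : 0 < B.
Proof.
have [x Cx] : C !=set0.
  by apply/set0P/eqP => C0; move: nuC; rewrite C0 measure0 => /eqP; rewrite eqe eq_sym oner_eq0.
by rewrite /B addr_gt0// (lt_le_trans ltr01)// (le_trans (V1 x))// VC.
Qed.

(* The state i.+1 records the age i, reset to 0 one step after each visit to C,
   as long as Phi (V X_k) + age has not exceeded Phi M; the state 0 is absorbing. *)
Definition age_update (M : R) (j : nat) (x : T) : nat :=
  if j is i.+1 then
    if M < flow i%:R (V x) then 0%N else if x \in C then 1%N else j.+1
  else 0%N.

Lemma age_update_le (M : R) (j : nat) (x : T) : (age_update M j x <= j.+1)%N.
Proof. by case: j => // i /=; case: ifP => // _; case: ifP. Qed.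

Lemma measurable_age_update (M : R) (i j : nat) :
  measurable [set x | age_update M j x = i].
Proof.
have mQ (Q : Prop) : measurable [set x : T | Q].
  have [q|q] := pselect Q.
    by have -> : [set _ : T | Q] = setT by apply/seteqP; split.
  by have -> : [set _ : T | Q] = set0 by apply/seteqP; split.
case: j => [|j] /=; first exact: mQ.
pose A := [set x | M < flow j%:R (V x)].
have mA : measurable A.
  have -> : A = setT `&` (flow j%:R \o V) @^-1` `]M, +oo[.
    by rewrite setTI; apply/seteqP; split => x; rewrite /A /= in_itv/= andbT.
  exact: measurable_flowV.
have -> : [set x | (if M < flow j%:R (V x) then 0%N
                    else if x \in C then 1%N else j.+2) = i] =
  (A `&` [set x | 0%N = i]) `|` (~` A `&` (C `&` [set x | 1%N = i])) `|`
  (~` A `&` (~` C `&` [set x | j.+2 = i])).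
  apply/seteqP; split => x /=.
    rewrite /A /=; case: ifPn => [Mx ix|/negP Mx]; first by left; left.
    case: ifPn => [/set_mem Cx ix|/negP Cx ix]; first by left; right.
    by right; split=> //; split=> // Cx'; apply: Cx; exact: mem_set.
  rewrite /A /= => -[[[-> //]|[/negP/negbTE ->] [Cx <-]]|[/negP/negbTE ->] [Cx <-]].
    by rewrite mem_set.
  by rewrite memNset.
by do 2?apply: measurableU; do 2?apply: measurableI => //; exact: measurableC.
Qed.

(** * The event that the level is exceeded *)

Section chain.
Context (d' : measure_display) (Omega : measurableType d')
  (Pr : probability Omega R) (X : nat -> {RV Pr >-> T}).
Hypothesis hX : markov_chain P mu X.

Lemma measurable_chain_memory (M : R) (n j : nat) :
  measurable [set w | memory X (age_update M) 1 n w = j].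
Proof.
apply: (measurable_past (X := fun k => X k : Omega -> T) _ (n := n)) => //.
apply: measurable_memory => //; exact: measurable_age_update.
Qed.

Lemma exceedance_probability (M : R) (n : nat) : 0 < M ->
  (Pr [set w | memory X (age_update M) 1 n w = 0%N] <=
   ((\int[mu]_x V x + B * n%:R) / M)%:E)%E.
Proof.
move=> M0; have B0 := return_bound_gt0.
(* Doob's argument with absorption in state 0, where H is 1; in the other states H is at least 1 as
   soon as the level M is crossed. The term B (n - k) pays in advance for a restart, of mean at most
   B, at each remaining step. *)
pose H k j x : \bar R :=
  (if j is i.+1 then M^-1 * (flow i%:R (V x) + B * (n - k)%:R) else 1)%:E.
have flow_pos i x : 0 <= flow i%:R (V x).
  by apply: le_trans (flow_ge phi_ge0 phi_conc phi_homo phi1 _ (V1 x)).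
have H0 k j x : (0 <= H k j x)%E.
  rewrite /H lee_fin; case: j => // i.
  by rewrite mulr_ge0 ?invr_ge0 ?(ltW M0)// addr_ge0// mulr_ge0// ltW.
have mH k j : measurable_fun setT (H k j).
  apply/measurable_EFinP; case: j => // i.
  by apply: measurable_funM => //; apply: measurable_funD => //; exact: measurable_flowV.
have H_step k j x : (k < n)%N ->
    ((cst 1 x)%:E * \int[P x]_y H k.+1 (age_update M j x) y <= H k j x)%E.
  move=> kn; rewrite mul1e.
  have int1 : (\int[P x]_y H k.+1 0%N y)%E = 1%:E.
    by rewrite EFin_Rintegral ?Rintegral_cst_P//; exact: integrable_cst_P.
  have intS i : (\int[P x]_y H k.+1 i.+1 y)%E =
     (M^-1 * (\int[P x]_y flow i%:R (V y) + B * (n - k.+1)%:R))%:E.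
    have ifl : (P x).-integrable setT (EFin \o (flow i%:R \o V)).
      by apply: integrable_flowV => //; exact: integrable_PV.
    have isum : (P x).-integrable setT
        (EFin \o (fun y => flow i%:R (V y) + B * (n - k.+1)%:R)).
      by apply: integrableD_EFin => //; exact: integrable_cst_P.
    rewrite EFin_Rintegral; last exact: integrableZl_EFin.
    rewrite RintegralZl// RintegralD// ?Rintegral_cst_P//.
    exact: integrable_cst_P.
  case: j => [|i] /=; first by rewrite int1.
  have nkS : (n - k)%:R = 1 + (n - k.+1)%:R :> R.
    by rewrite -(natrD _ 1%N) add1n subnSK.
  case: ifPn => [Mx|_].
    rewrite int1 lee_fin mulrC ler_pdivlMr// mul1r (le_trans (ltW Mx))// lerDl.
    by rewrite mulr_ge0// ltW.
  case: ifPn => [/set_mem Cx|/negP Cx]; rewrite intS lee_fin ler_wpM2l ?invr_ge0 ?(ltW M0)//.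
    under eq_Rintegral do rewrite flow0//.
    by have := V_drift_C Cx; have := flow_pos i x; rewrite nkS; lra.
  have Cx' : ~ C x by move=> /mem_set.
  have := @flowV_drift x i%:R (ler0n _ _) Cx'; rewrite natr1 nkS; lra.
have := @supermartingale _ _ _ _ _ _ _ _ _ hX (age_update M) 1 (cst 1)
  (age_update_le M) (measurable_age_update M) (measurable_cst _) (fun=> ler01)
  n H mH H0 H_step.
have -> : (\int[mu]_x H 0%N 1%N x)%E = ((\int[mu]_x V x + B * n%:R) / M)%:E.
  have iV := integrable_muV.
  have icst c : mu.-integrable setT (EFin \o (fun _ : T => c)).
    by apply: (@bounded_integrable _ _ _ _ _ `|c|) => //; exact: probability_setT.
  rewrite /H subn0.
  under eq_integral do rewrite flow0//.
  rewrite EFin_Rintegral; last by apply: integrableZl_EFin; exact: integrableD_EFin.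
  rewrite RintegralZl//; last exact: integrableD_EFin.
  by rewrite RintegralD// Rintegral_cst//= probability_setT/= mulr1 mulrC.
apply: le_trans.
rewrite -[X in (Pr X)]setIT -integral_indic//; last exact: measurable_chain_memory.
apply: ge0_le_integral => //.
- by apply/measurable_EFinP; apply: measurable_indic; exact: measurable_chain_memory.
- apply: emeasurable_funM.
    apply/measurable_EFinP.
    apply: (measurable_fun_past (X := fun k => X k : Omega -> T) _ (n := n)) => //.
    by apply: measurable_weight.
  apply: (measurable_fun_nat_index (u := fun j w => H n j (X n w))).
    by move=> j; exact: measurable_chain_memory.
  by move=> j; apply: (measurableT_comp (mH n j)).
- move=> w _; rewrite /weight big1// mul1e indicE.
  by case: (boolP (w \in _)) => [/set_mem /= ->|_] //=; exact: H0.
Qed.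

End chain.

(** The supermartingale takes the value 0 in the absorbing state, so only paths that stay below the
    level count. The supersolution W has mean at most 2 at time 0 and is at least 1/2 at time n,
    whence the factor 4. *)
Lemma exponential_bound (f g : T -> R) (F c A e : R) :
  0 < F -> measurable_fun setT f -> (forall x, `|f x| <= F) ->
  0 < c -> measurable_fun setT g -> (forall x, `|g x| <= c * (Phi (V x) + 1)) ->
  (forall x, (P x).-integrable setT (EFin \o g)) ->
  (forall x, g x = f x + \int[P x]_y g y) ->
  0 < A -> 0 < e ->
  exists2 t0, 0 < t0 & forall t, t0 <= t ->
  forall (d' : measure_display) (Omega : measurableType d')
    (Pr : probability Omega R) (X : nat -> {RV Pr >-> T}),
    markov_chain P mu X -> forall n : nat,
  (Pr [set w | memory X (age_update (Phi_inv t)) 1 n w <> 0%N /\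
               (e * n%:R < \sum_(k < n) f (X k w))%R] <=
   (4 * expR (- (A / t * (e / 2) * n%:R)))%:E)%E.
Proof.
move=> F0 mf fF c0 mg gc ig gE A0 e0.
have B0 := return_bound_gt0.
(* Half of e tilts f to f - dl; the other half gives the rate l dl of the exponential. *)
pose dl := e / 2; have dl0 : 0 < dl by rewrite divr_gt0.
pose G := F + dl; have G0 : 0 < G by rewrite addr_gt0.
pose s := dl / (2 * G).
have Gs : G * s = dl / 2 by rewrite /s; field; rewrite gt_eqF.
have s0 : 0 < s by rewrite divr_gt0// mulr_gt0.
have s12 : s <= 1 / 2.
  by rewrite /s ler_pdivrMr ?mulr_gt0//; rewrite /G; lra.
(* a = 4 G makes the decay of one step beat 2 l G; kap B = dl / 4 is the quarter allotted to a
   restart; q bounds the decay from below; eta makes c (Phi V + 1) <= kap q V / 2 for large V, hence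
   |l g| <= w / 2 there. *)
pose a := 4 * G; have a0 : 0 < a by rewrite mulr_gt0.
pose kap := dl / (4 * B); have kap0 : 0 < kap by rewrite divr_gt0// mulr_gt0.
pose q := expR (- (a * (2 * A))); have q0 : 0 < q by rewrite expR_gt0.
pose eta := kap * q / (2 * c); have eta0 : 0 < eta by rewrite divr_gt0// mulr_gt0.
have [v0 v01 hv0] := Phi_sublinear phi_ge0 phi_homo phi1 phi_y eta0.
(* The maximum with vC places C in the region where |l g| <= s. *)
pose v1 := Num.max v0 vC.
have v11 : 1 <= v1 by rewrite le_max v01.
pose m0 := c * (\int[mu]_x Phi (V x) + 1) + kap * \int[mu]_x V x.
pose t1 := A * c * (Phi v1 + 1) / s.
have PhiV1 x : 0 <= Phi (V x) by exact: Phi_ge0.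
have Phiv1 : 0 <= Phi v1 by exact: Phi_ge0.
have t10 : 0 <= t1.
  by rewrite divr_ge0 ?(ltW s0)// mulr_ge0 ?addr_ge0// mulr_ge0 ?(ltW A0) ?(ltW c0).
have m00 : 0 <= m0.
  rewrite addr_ge0// mulr_ge0 ?addr_ge0 ?(ltW c0) ?(ltW kap0)//.
    by apply: Rintegral_ge0 => x _.
  by apply: Rintegral_ge0 => x _.
(* Beyond this sum, l = A / t satisfies a l <= 1, l m0 <= 1, which bounds the initial mean by 2, and
   l c (Phi v1 + 1) <= s; the summand 1 gives l (t + 1) <= 2 A. *)
exists (1 + a * A + A * m0 + t1).
  have : 0 < a * A by rewrite mulr_gt0.
  have : 0 <= A * m0 by rewrite mulr_ge0// ltW.
  lra.
move=> t ht d' Omega Pr X hX n.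
have [t_1 t_aA t_m0 t_t1] : [/\ 1 <= t, a * A <= t, A * m0 <= t & t1 <= t].
  have : 0 < a * A by rewrite mulr_gt0.
  have : 0 <= A * m0 by rewrite mulr_ge0// ltW.
  by move=> *; split; lra.
have t0 : 0 < t by exact: lt_le_trans t_1.
pose l := A / t; have l0 : 0 < l by rewrite divr_gt0.
have tl : l * t = A by rewrite /l divfK// gt_eqF.
have la : a * l <= 1 by rewrite /l mulrA ler_pdivrMr// mul1r.
have lm0 : l * m0 <= 1 by rewrite /l mulrAC ler_pdivrMr// mul1r.
have lc : l * (c * (Phi v1 + 1)) <= s.
  rewrite /l mulrAC ler_pdivrMr// mulrA [leRHS]mulrC.
  by move: t_t1; rewrite /t1 ler_pdivrMr.
have lt2 : l * (t + 1) <= 2 * A.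
  have : l * 1 <= l * t by rewrite ler_pM2l.
  by rewrite mulrDr tl; lra.
have lG : l * G <= 1 by move: la; rewrite /a; have : 0 < l * G by [exact: mulr_gt0]; lra.
(* Capping the age at t + 1 keeps the decay above q for every i. Below the level i <= t, so the step
   from i to i + 1 does not meet the cap. *)
pose decay (i : nat) : R := expR (- (a * (l * Num.min i%:R (t + 1)))).
have decay_ge i : q <= decay i.
  rewrite ler_expR lerN2 ler_pM2l//; apply: le_trans lt2.
  by rewrite ler_pM2l// ge_min lexx orbT.
have decay0 i : 0 < decay i by exact: expR_gt0.
have decay_0 : decay 0%N = 1.
  by rewrite /decay min_l ?mulr0 ?oppr0 ?expR0// addr_ge0// ltW.
have flow_geV i x : V x <= flow i%:R (V x).
  exact: (flow_ge phi_ge0 phi_conc phi_homo phi1).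
pose w i x := l * kap * decay i * flow i%:R (V x).
have lk0 : 0 < l * kap by exact: mulr_gt0.
have w_ge i x : l * kap * q * V x <= w i x.
  by rewrite /w ler_pM ?(ltW (mulr_gt0 lk0 q0))// ler_pM2l.
have w0 i x : 0 <= w i x.
  by apply: le_trans (w_ge i x); rewrite mulr_ge0 ?(ltW (mulr_gt0 lk0 q0)).
have dichotomy i x : `|l * g x| <= s \/ `|l * g x| <= w i x / 2.
  rewrite normrM (gtr0_norm l0).
  have h : l * `|g x| <= l * (c * (Phi (V x) + 1)) by rewrite ler_pM2l.
  have [Vv|/ltW vV] := leP (V x) v1.
    left; apply: le_trans h (le_trans _ lc).
    by rewrite !ler_pM2l// lerD2r Phi_le.
  right; apply: le_trans h _.
  have vV0 : v0 <= V x by apply: le_trans vV; rewrite le_max lexx.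
  apply: (@le_trans _ _ (l * (c * (eta * V x)))); first by rewrite !ler_pM2l// hv0.
  have := w_ge i x; have -> : l * (c * (eta * V x)) = l * kap * q * V x / 2.
    by rewrite /eta; field; rewrite gt_eqF.
  lra.
have on_C x : C x -> `|l * g x| <= s.
  move=> Cx; rewrite normrM (gtr0_norm l0).
  apply: (@le_trans _ _ (l * (c * (Phi (V x) + 1)))); first by rewrite ler_pM2l.
  apply: le_trans lc; rewrite !ler_pM2l// lerD2r Phi_le//.
  by rewrite le_max VC ?orbT.
pose W i x := 1 + l * g x + w i x.
have W12 i x : 1 / 2 <= W i x.
  rewrite /W; have := dichotomy i x; rewrite !ler_norml; have := w0 i x.
  by case=> w_0 [] /andP[]; lra.
have fdl x : `|f x - dl| <= G.
  by rewrite /G (le_trans (ler_normB _ _))// (gtr0_norm dl0) lerD2r.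
have q1 x : 1 - l * (f x - dl) <= expR (- (l * (f x - dl))).
  exact: expR_ge1Dx.
have iflow i x : (P x).-integrable setT (EFin \o (fun y => flow i%:R (V y))).
  by apply: integrable_flowV => //; exact: integrable_PV.
have iw i x : (P x).-integrable setT (EFin \o w i) by exact: integrableZl_EFin.
have i1g x : (P x).-integrable setT (EFin \o (fun y => 1 + l * g y)).
  apply: integrableD_EFin; first exact: integrable_cst_P.
  exact: integrableZl_EFin.
have intW i x : (\int[P x]_y (W i y)%:E)%E =
    (1 + (l * g x - l * f x) + l * kap * decay i * \int[P x]_y flow i%:R (V y))%:E.
  rewrite EFin_Rintegral; last exact: integrableD_EFin.
  rewrite RintegralD// RintegralD//; [|exact: integrable_cst_P|exact: integrableZl_EFin].
  rewrite Rintegral_cst_P RintegralZl// RintegralZl//.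
  by have := gE x => gEx; congr (_ + _ + _)%:E; rewrite -mulrBr {1}gEx addrC addKr.
pose H (k j : nat) x : \bar R := (if j is i.+1 then W i x else 0)%:E.
have H0 k j x : (0 <= H k j x)%E.
  by rewrite lee_fin; case: j => // i; exact: le_trans (W12 i x).
have mW i : measurable_fun setT (W i).
  apply: measurable_funD; last by apply: measurable_funM => //; exact: measurable_flowV.
  by apply: measurable_funD => //; exact: measurable_funM.
have mH k j : measurable_fun setT (H k j).
  by apply/measurable_EFinP; case: j.
pose zeta x := expR (l * (f x - dl)).
have zeta0 x : 0 <= zeta x by exact: expR_ge0.
have mzeta : measurable_fun setT zeta.
  apply: measurableT_comp => //; apply: measurable_funM => //.
  exact: measurable_funB.
(* As 1 - z <= exp (- z), the exponential one-step inequality follows from the linear ones of the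
   two supersolution lemmas. *)
have zeta_le x (a1 a2 : R) : 0 <= a2 -> a1 <= (1 - l * (f x - dl)) * a2 ->
    zeta x * a1 <= a2.
  move=> a20 h; apply: (@le_trans _ _ (zeta x * (expR (- (l * (f x - dl))) * a2))).
    by apply: ler_wpM2l => //; apply: le_trans h _; rewrite ler_wpM2r.
  by rewrite mulrA -expRD subrr expR0 mul1r.
have H_step k j x : (k < n)%N ->
    ((zeta x)%:E * \int[P x]_y H k.+1 (age_update (Phi_inv t) j x) y <= H k j x)%E.
  move=> _; rewrite /H; case: j => [|i] /=; first by rewrite integral0 mule0.
  have Wi0 : 0 <= W i x by exact: le_trans (W12 i x).
  case: ifPn => [_|]; first by rewrite integral0 mule0 lee_fin.
  rewrite -leNgt => flow_t.
  have i_t : i%:R <= t.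
    have := @Phi_le R phi phi_ge0 phi_homo phi1 _ _ (le_trans (V1 x) (flow_geV i x)) flow_t.
    rewrite Phi_flow// Phi_invK// ?(ltW t0)//.
    by apply: le_trans; rewrite lerDr.
  case: ifPn => [/set_mem Cx|/negP Cx]; rewrite intW -EFinM lee_fin; apply: zeta_le => //.
    under eq_Rintegral do rewrite flow0//.
    rewrite decay_0.
    have := supersolution_regeneration l0 lG Gs dl0 (fdl x) (on_C _ Cx) (w0 i x).
    apply: le_trans; rewrite lerD2l mulr1 -[l * kap * _]mulrA -[l * dl / 4]mulrA ler_pM2l//.
    apply: (@le_trans _ _ (kap * B)); first by rewrite ler_pM2l// V_drift_C.
    by rewrite le_eqVlt; apply/orP; left; apply/eqP; rewrite /kap; field; rewrite gt_eqF.
  have Cx' : ~ C x by move=> /mem_set.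
  have := supersolution_excursion l0 Gs dl0 (ltW G0) (fdl x) (dichotomy i x) (w0 i x).
  apply: le_trans; rewrite lerD2l.
  have drift := @flowV_drift x i%:R (ler0n _ _) Cx'; rewrite natr1 in drift.
  have decayS : decay i.+1 = expR (- (a * l)) * decay i.
    rewrite /decay !min_l; [|by lra|by rewrite -natr1 lerD2r].
    by rewrite -expRD -natr1; congr expR; ring.
  have al0 : 0 <= a * l by rewrite mulr_ge0// ltW.
  have e1 := expRN_le al0 la.
  rewrite decayS.
  apply: (@le_trans _ _ (expR (- (a * l)) * w i x)).
    have -> : l * kap * (expR (- (a * l)) * decay i) * \int[P x]_y flow i.+1%:R (V y)
      = expR (- (a * l)) * (l * kap * decay i * \int[P x]_y flow i.+1%:R (V y)) by ring.
    by rewrite ler_pM2l ?expR_gt0// /w ler_pM2l// mulr_gt0.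
  apply: ler_wpM2r => //; apply: le_trans e1 _.
  by rewrite /a; lra.
have := @supermartingale _ _ _ _ _ _ _ _ _ hX (age_update (Phi_inv t)) 1 zeta
  (age_update_le _) (measurable_age_update _) mzeta zeta0 n H mH H0 H_step.
have iV := integrable_muV.
have mu1 : mu setT = 1%E by exact: probability_setT.
have init : (\int[mu]_x H 0%N 1%N x <= 2%:E)%E.
  have icst (z : R) : mu.-integrable setT (EFin \o (fun _ : T => z)).
    by apply: (@bounded_integrable _ _ _ _ _ `|z|).
  have iPhi := integrable_PhiV mu1 iV.
  have ib1 : mu.-integrable setT (EFin \o (fun x => Phi (V x) + 1)).
    exact: integrableD_EFin.
  have ib2 : mu.-integrable setT (EFin \o (fun x => c * (Phi (V x) + 1) + kap * V x)).
    by apply: integrableD_EFin; exact: integrableZl_EFin.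
  have ib : mu.-integrable setT
      (EFin \o (fun x => 1 + l * (c * (Phi (V x) + 1) + kap * V x))).
    by apply: integrableD_EFin => //; exact: integrableZl_EFin.
  apply: (@le_trans _ _ (\int[mu]_x (1 + l * (c * (Phi (V x) + 1) + kap * V x))%:E)%E).
    apply: ge0_le_integral => //.
    - exact: (measurable_int _ ib).
    - move=> x _; rewrite lee_fin /W /w flow0// -addrA lerD2l mulrDr lerD//.
        by rewrite ler_pM2l// (le_trans (ler_norm _)).
      by rewrite decay_0 mulr1 -[l * kap * _]mulrA.
  rewrite EFin_Rintegral// RintegralD//; last exact: integrableZl_EFin.
  rewrite RintegralZl// RintegralD//; [|exact: integrableZl_EFin|exact: integrableZl_EFin].
  rewrite RintegralZl// RintegralD// RintegralZl//.
  rewrite !Rintegral_cst//= mu1/= !mulr1 lee_fin.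
  by move: lm0; rewrite /m0; lra.
move=> /le_trans /(_ init) main.
set S := [set w | _ /\ _].
have mS : measurable S.
  have -> : S = ~` [set w | memory X (age_update (Phi_inv t)) 1 n w = 0%N] `&`
      (setT `&` (fun w => \sum_(k < n) f (X k w)) @^-1` `]e * n%:R, +oo[).
    rewrite setTI; apply/seteqP; split => z; rewrite /S /= in_itv/= andbT//.
  apply: measurableI; first by apply: measurableC; exact: measurable_chain_memory.
  have msum : measurable_fun setT (fun w => \sum_(k < n) f (X k w)).
    by apply: measurable_sum => k; exact: measurableT_comp.
  exact: msum.
(* On S the weight is at least exp (l (e - dl) n) = exp (l dl n), and W is at least 1/2. *)
pose z := expR (l * dl * n%:R) / 2.
have z0 : 0 < z by rewrite divr_gt0// expR_gt0.
have low : (z%:E * Pr S <= 2%:E)%E.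
  apply: le_trans main.
  rewrite -[X in (_ * Pr X)%E]setIT -integral_indic//.
  rewrite -ge0_integralZl ?lee_fin ?(ltW z0)//; first last.
    by apply/measurable_EFinP; exact: measurable_indic.
  apply: ge0_le_integral => //.
  - by move=> y _; rewrite mule_ge0// lee_fin ?(ltW z0).
  - by apply: measurable_funeM; apply/measurable_EFinP; exact: measurable_indic.
  - apply: emeasurable_funM.
      apply/measurable_EFinP.
      apply: (measurable_fun_past (X := fun k => X k : Omega -> T) _ (n := n)) => //.
      by apply: measurable_weight.
    apply: (measurable_fun_nat_index (u := fun j w => H n j (X n w))).
      by move=> j; exact: measurable_chain_memory.
    by move=> j; apply: (measurableT_comp (mH n j)).
  - move=> y _; rewrite indicE.
    have wt0 : (0 <= (weight X zeta n y)%:E)%E by rewrite lee_fin; exact: weight_ge0.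
    case: (boolP (y \in S)) => [/set_mem [my Sy]|_]; last by rewrite mule0 mule_ge0.
    move: my; case: (memory _ _ _ _ _) => // i _; rewrite mule1 /H -EFinM lee_fin.
    have weightE : weight X zeta n y = expR (\sum_(k < n) l * (f (X k y) - dl)).
      by rewrite /weight /zeta expR_sum.
    apply: ler_pM; rewrite ?expR_ge0 ?invr_ge0//; last first.
      by have := W12 i (X n y); rewrite mul1r.
    rewrite weightE ler_expR -mulr_sumr -mulrA ler_pM2l// sumrB sumr_const card_ord.
    rewrite -[dl *+ n]mulr_natr; move: Sy; have -> : e = dl + dl by rewrite /dl; field.
    by rewrite mulrDl; lra.
have Pfin : Pr S \is a fin_num by exact: fin_num_measure.
move: low; rewrite -(fineK Pfin) -EFinM !lee_fin => low.
have -> : A / t * (e / 2) * n%:R = l * dl * n%:R by [].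
rewrite expRN -(ler_pM2l z0); apply: le_trans low _.
rewrite /z; set E := expR _; have E0 : E != 0 by rewrite gt_eqF// expR_gt0.
by rewrite le_eqVlt; apply/orP; left; apply/eqP; field.
Qed.

(** * From one component to the Euclidean norm *)

Lemma component_bound (h : T -> R) (F A e : R) :
  0 < F -> measurable_fun setT h -> (forall x, `|h x| <= F) ->
  \int[pi]_x h x = 0 -> 0 < A -> 0 < e ->
  exists2 t0, 0 < t0 & forall t, t0 <= t ->
  forall (d' : measure_display) (Omega : measurableType d')
    (Pr : probability Omega R) (X : nat -> {RV Pr >-> T}),
    markov_chain P mu X -> forall n : nat,
  (Pr [set w | memory X (age_update (Phi_inv t)) 1 n w <> 0%N /\
               (e * n%:R < \sum_(k < n) h (X k w))%R] <=
   (4 * expR (- (A / t * (e / 2) * n%:R)))%:E)%E.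
Proof.
move=> F0 mh hF pih A0 e0.
have [g [c [c0 mg gc ig gE]]] := bounded_poisson_equation F0 mh hF pih.
exact: exponential_bound F0 mh hF c0 mg gc ig gE A0 e0.
Qed.

(** Each of the 2 p signed components contributes 4 exponentials. The crossing of the level is
    counted once, since the age process is the same for all of them. *)
Lemma deviation_bound (p : nat) (f : T -> 'rV[R]_p) (F A e : R) :
  0 < F -> (forall i, measurable_fun setT (fun x => f x ord0 i)) ->
  (forall x i, `|f x ord0 i| <= F) ->
  (forall i, \int[pi]_x f x ord0 i = 0) -> 0 < A -> 0 < e ->
  exists2 t0, 0 < t0 & forall t, t0 <= t ->
  forall (d' : measure_display) (Omega : measurableType d')
    (Pr : probability Omega R) (X : nat -> {RV Pr >-> T}),
    markov_chain P mu X -> forall n : nat,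
  (Pr [set w | (e * p.+1%:R * n%:R < enorm (\sum_(k < n) f (X k w)))%R] <=
   ((\int[mu]_x V x + B * n%:R) / Phi_inv t +
    (8 * p)%:R * expR (- (A / t * (e / 2) * n%:R)))%:E)%E.
Proof.
move=> F0 mf fF pif A0 e0.
pose comp (i : 'I_p * bool) x := (-1) ^+ i.2 * f x ord0 i.1.
have mcomp i : measurable_fun setT (comp i) by exact: measurable_funM.
have compF i x : `|comp i x| <= F by rewrite /comp normrM normrX normrN1 expr1n mul1r.
have icomp i : \int[pi]_x comp i x = 0.
  rewrite RintegralZl ?pif ?mulr0//.
  by apply: (@bounded_integrable _ _ _ _ _ F) => //; exact: probability_setT.
have bound i := component_bound F0 (mcomp i) (compF i) (icomp i) A0 e0.
have [tt tt_] : {tt : 'I_p * bool -> R | forall i, 0 < tt i /\ forall t, tt i <= t ->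
  forall (d' : measure_display) (Omega : measurableType d')
    (Pr : probability Omega R) (X : nat -> {RV Pr >-> T}),
    markov_chain P mu X -> forall n : nat,
  (Pr [set w | memory X (age_update (Phi_inv t)) 1 n w <> 0%N /\
               (e * n%:R < \sum_(k < n) comp i (X k w))%R] <=
   (4 * expR (- (A / t * (e / 2) * n%:R)))%:E)%E}.
  exists (fun i => sval (cid2 (bound i))) => i.
  by case: (cid2 (bound i)).
exists (1 + \sum_i tt i).
  by rewrite ltr_pwDl// sumr_ge0// => i _; have [/ltW] := tt_ i.
move=> t ht d' Omega Pr X hX n.
have t_ge i : tt i <= t.
  apply: le_trans ht; rewrite (bigD1 i)//= addrCA lerDl addr_ge0// sumr_ge0// => j _.
  by have [/ltW] := tt_ j.
have t0 : 0 <= t.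
  by apply: le_trans ht; rewrite addr_ge0// sumr_ge0// => i _; have [/ltW] := tt_ i.
have M0 : 0 < Phi_inv t.
  by apply: lt_le_trans ltr01 _; exact: Phi_inv_ge1.
pose J0 := [set w | memory X (age_update (Phi_inv t)) 1 n w = 0%N].
pose S i := [set w | memory X (age_update (Phi_inv t)) 1 n w <> 0%N /\
   (e * n%:R < \sum_(k < n) comp i (X k w))%R].
have mJ0 : measurable J0 by exact: measurable_chain_memory.
have mS i : measurable (S i).
  have -> : S i = ~` J0 `&`
      (setT `&` (fun w => \sum_(k < n) comp i (X k w)) @^-1` `]e * n%:R, +oo[).
    by rewrite setTI; apply/seteqP; split => z; rewrite /S /= in_itv/= andbT.
  apply: measurableI; first exact: measurableC.
  have msum : measurable_fun setT (fun w => \sum_(k < n) comp i (X k w)).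
    by apply: measurable_sum => k; apply: measurableT_comp => //.
  exact: msum.
set E := [set w | _].
have mE : measurable E.
  have -> : E = setT `&` (fun w => enorm (\sum_(k < n) f (X k w))) @^-1`
      `]e * p.+1%:R * n%:R, +oo[.
    by rewrite setTI; apply/seteqP; split => z; rewrite /E /= in_itv/= andbT.
  have mn : measurable_fun setT (fun w => enorm (\sum_(k < n) f (X k w))).
    apply: (measurable_enorm (v := fun w => \sum_(k < n) f (X k w))) => i.
    under eq_fun do rewrite summxE.
    by apply: measurable_sum => k; apply: (measurableT_comp (mf i)).
  exact: mn.
have sub : E `<=` J0 `|` \big[setU/set0]_(i <- index_enum ('I_p * bool)%type) S i.
  move=> w /= Ew; have [wJ|wJ] := pselect (J0 w); [by left|right].
  have := @enorm_large_component _ _ (\sum_(k < n) f (X k w)) (e * n%:R).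
  rewrite mulr_ge0 ?(ltW e0)// mulrAC => /(_ isT Ew) [i hi].
  rewrite -bigcup_seq; exists i; first by rewrite /= mem_index_enum.
  split=> //; move: hi; rewrite summxE mulr_sumr; exact.
have mU : measurable (\big[setU/set0]_(i <- index_enum ('I_p * bool)%type) S i).
  exact: bigsetU_measurable.
apply: (@le_trans _ _ (Pr (J0 `|` \big[setU/set0]_(i <- index_enum ('I_p * bool)%type) S i))).
  by apply: le_measure => //; rewrite inE//; exact: measurableU.
apply: le_trans (measureU2 _ mJ0 mU) _.
rewrite EFinD; apply: leeD; first exact: exceedance_probability.
have := @union_bound _ _ _ Pr _ (index_enum ('I_p * bool)%type) S
  (4 * expR (- (A / t * (e / 2) * n%:R))) mS
  (fun i => (tt_ i).2 t (t_ge i) _ _ Pr X hX n).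
suff -> : (size (index_enum ('I_p * bool)%type))%:R *
  (4 * expR (- (A / t * (e / 2) * n%:R))) =
  (8 * p)%:R * expR (- (A / t * (e / 2) * n%:R)) :> R by [].
rewrite -[index_enum _]enumT -cardE card_prod card_ord card_bool.
by rewrite mulrA -natrM; congr (_%:R * _); rewrite -mulnA mulnC.
Qed.

End drift.

(** * Choice of the level and of the constants *)

Theorem theorem10 (R : realType) (disp : measure_display)
    (T : measurableType disp) (P : R.-pker T ~> T) (pi : probability T R)
    (C : set T) (phi : R -> R) (V : T -> R)
    (d : nat) (f : T -> 'rV[R]_d) (mu : probability T R)
    (hT : countably_generated T)
    (hP : positive_harris_recurrent P pi)
    (hA1 : minorization P C)
    (hA2 : drift_condition P C phi V)
    (f_meas : forall i : 'I_d, measurable_fun setT (fun x => f x ord0 i))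
    (f_bounded : exists M : R, forall x, enorm (f x) <= M)
    (f_nonzero : exists x, f x != 0)
    (f_centered : forall i : 'I_d, (\int[pi]_x (f x ord0 i)%:E = 0)%E)
    (muV : (\int[mu]_x (V x)%:E < +oo)%E) :
  exists L K : R, 0 < L /\ 0 < K /\
    forall eps : R, 0 < eps ->
    exists n0 : nat,
    forall (disp' : measure_display) (Omega : measurableType disp')
      (Pr : probability Omega R) (X : nat -> {RV Pr >-> T}),
      markov_chain P mu X ->
    forall n : nat, (n0 < n)%N ->
    forall y : R, 0 < y ->
      (Pr [set w | (eps * n%:R < enorm (\sum_(k < n) f (X k w)))%R] <=
       (L * n%:R / Phi_inv phi (eps * n%:R / supnorm f)
        + L * n%:R / Phi_inv phi (y / supnorm f)
        + expR (- (n%:R * eps ^+ 2 / (K * supnorm f ^+ 2 + eps * y))))%:E)%E.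

Proof.
case: hP => _ pi_inv.
case: hA1 => mC [e [nu [/andP[e0 _] nuC minor]]].
case: hA2 => -[phi_ge0 phi_conc phi_homo _] [phi1 phi_y _] [mV V1 [vC hvC]] [b b0 PV].
have VC x : C x -> V x <= vC by move=> Cx; apply: hvC; exists x.
pose F := supnorm f.
have fF x : enorm (f x) <= F.
  by apply: ub_le_sup; [have [M hM] := f_bounded; exists M => _ [y _ <-]|exists x].
have compF x i : `|f x ord0 i| <= F by apply: le_trans (fF x); exact: normr_le_enorm.
have F0 : 0 < F.
  have [x fx] := f_nonzero; apply: lt_le_trans (fF x).
  rewrite lt_neqAle sqrtr_ge0 andbT; apply: contra fx => /eqP fx0.
  apply/eqP/rowP => i; rewrite mxE; apply/eqP; rewrite -normr_le0 [leRHS]fx0.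
  exact: normr_le_enorm.
have pif i : \int[pi]_x f x ord0 i = 0 by rewrite /Rintegral f_centered.
have B0 : 0 < vC + b by apply: (@return_bound_gt0 R _ T nu C b vC V).
have mV0 : 0 <= \int[mu]_x V x.
  by apply: Rintegral_ge0 => x _; exact: le_trans (V1 x).
(* For n >= 1 this gives mu(V) + B n <= L n; the summand 1 makes L >= 1, which serves when y is
   small. *)
pose L := \int[mu]_x V x + (vC + b) + 1.
have L1 : 1 <= L by rewrite lerDr addr_ge0// ltW.
have L0 : 0 < L by exact: lt_le_trans L1.
(* The exponential proved below is exp (- eps n / y), which does not exceed the stated one for K =
   1. *)
exists L, 1; split=> //; split=> // eps eps0.
pose N : R := (8 * d)%:R; have N0 : 0 <= N by exact: ler0n.
(* With eps / (d + 1) as the deviation of a component, this A gives the exponent 3 eps n / (F t),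
   that is 3 eps n / y at t = y / F. *)
pose A := 6 * d.+1%:R / F; have A0 : 0 < A by rewrite divr_gt0// mulr_gt0// ltr0n.
have ed0 : 0 < eps / d.+1%:R by rewrite divr_gt0// ltr0n.
have [t0 t00 core] : exists2 t0, 0 < t0 & forall t, t0 <= t ->
  forall (disp' : measure_display) (Omega : measurableType disp')
    (Pr : probability Omega R) (X : nat -> {RV Pr >-> T}),
    markov_chain P mu X -> forall n : nat, (0 < n)%N ->
  (Pr [set w | (eps * n%:R < enorm (\sum_(k < n) f (X k w)))%R] <=
   (L * n%:R / Phi_inv phi t + N * expR (- (3 * (eps * n%:R / (F * t)))))%:E)%E.
  have [t0 t00 h] := deviation_bound mC e0 nuC minor pi_inv phi_ge0 phi_conc phi_homo
    phi1 phi_y mV V1 VC b0 PV muV F0 f_meas compF pif A0 ed0.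
  exists t0 => // t tt0 disp' Omega Pr X hX n n0.
  have t_0 : 0 < t by exact: lt_le_trans tt0.
  have M1 := Phi_inv_ge1 phi_ge0 phi_conc phi_homo phi1 (ltW t_0).
  have := h t tt0 _ _ Pr X hX n.
  rewrite divfK ?pnatr_eq0// => /le_trans; apply; rewrite lee_fin lerD//.
    rewrite ler_wpM2r ?invr_ge0 ?(le_trans ler01 M1)//.
    have n1 : (1 : R) <= n%:R by rewrite ler1n.
    rewrite /L !mulrDl; rewrite -addrA lerD// ?ler_peMr//.
    by rewrite lerDl mul1r.
  rewrite ler_wpM2l// ler_expR lerN2 le_eqVlt; apply/orP; left; apply/eqP.
  rewrite /A; field.
  by rewrite !gt_eqF ?ltr0n.
(* For z >= 1 / c one has N <= 1 + z <= exp z, so a third of the exponent 3 z absorbs the factor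
   N. *)
pose c := (N + 1)^-1.
have N10 : 0 < N + 1 by rewrite ltr_wpDl.
have c0 : 0 < c by rewrite invr_gt0.
(* The room available when y > c eps n: there exp (- eps n / y) >= exp (- 1 / c), while the
   exponential part of the estimate is at most exp (- 2 / c). The constant eta is fitted so that eta
   L n / gam = c eps n / F, the level used in that case. *)
pose gam := expR (- c^-1) - expR (- (2 * c^-1)).
have gam0 : 0 < gam by rewrite subr_gt0 ltr_expR ltrN2 ltr_pMl ?invr_gt0// ltr1n.
pose eta := c * eps * gam / (F * L).
have eta0 : 0 < eta by rewrite divr_gt0 ?mulr_gt0.
have [v0 v01 hv0] := Phi_sublinear phi_ge0 phi_homo phi1 phi_y eta0.
have M1 t : 0 <= t -> 1 <= Phi_inv phi t by exact: Phi_inv_ge1.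
(* The summands serve, in turn, the case y / F < t0, the requirement t0 <= c eps n / F, and v0 <= L
   n / gam. *)
pose m0 := Phi_inv phi t0 + t0 * F / (c * eps) + v0 * gam / L.
exists (Num.truncn m0) => disp' Omega Pr X hX n nn y y0.
have n_pos : (0 < n)%N by exact: leq_ltn_trans nn.
have nR : (0 : R) < n%:R by rewrite ltr0n.
have nm0 : m0 <= n%:R.
  by apply: le_trans (ltW (truncnS_gt m0)) _; rewrite ler_nat.
have a1 : 1 <= Phi_inv phi t0 by apply: M1; exact: ltW.
have a2 : 0 <= t0 * F / (c * eps) by rewrite divr_ge0 ?mulr_ge0// ltW.
have a3 : 0 <= v0 * gam / L.
  by rewrite divr_ge0 ?mulr_ge0// ?(le_trans ler01 v01)// ltW.
have n1 : Phi_inv phi t0 <= n%:R by move: nm0; rewrite /m0; lra.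
have n2 : t0 * F / (c * eps) <= n%:R by move: nm0; rewrite /m0; lra.
have n3 : v0 * gam / L <= n%:R by move: nm0; rewrite /m0; lra.
have yF0 : 0 < y / F by rewrite divr_gt0.
have Ln0 : 0 <= L * n%:R by rewrite mulr_ge0// ltW.
have Ldiv t : 0 <= t -> 0 <= L * n%:R / Phi_inv phi t.
  by move=> t_0; rewrite divr_ge0// (le_trans ler01)// M1.
have ldiv1 : 0 <= L * n%:R / Phi_inv phi (eps * n%:R / F).
  by apply: Ldiv; rewrite divr_ge0 ?mulr_ge0// ltW.
pose x := eps * n%:R / y.
have x0 : 0 < x by rewrite divr_gt0// mulr_gt0.
have tail : expR (- x) <= expR (- (n%:R * eps ^+ 2 / (1 * F ^+ 2 + eps * y))).
  rewrite ler_expR lerN2 ler_pdivrMr; last by rewrite ltr_wpDl ?mulr_gt0// mul1r sqr_ge0.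
  have -> : x * (1 * F ^+ 2 + eps * y) = n%:R * eps ^+ 2 + x * F ^+ 2.
    by rewrite /x; field; rewrite gt_eqF.
  by rewrite lerDl mulr_ge0 ?sqr_ge0// ltW.
suff key : (Pr [set w | (eps * n%:R < enorm (\sum_(k < n) f (X k w)))%R] <=
    (L * n%:R / Phi_inv phi (y / F) + expR (- x))%:E)%E.
  apply: le_trans key _; rewrite lee_fin -addrA -[leLHS]add0r lerD// lerD//.
(* Below t0 the term L n / Phi^-1 (y / F) is already at least 1, because n >= Phi^-1 t0 and L >=
   1. *)
have [tlt|tge] := ltP (y / F) t0.
  have mS : measurable_fun setT (fun w => enorm (\sum_(k < n) f (X k w))).
    apply: (measurable_enorm (v := fun w => \sum_(k < n) f (X k w))) => i.
    under eq_fun do rewrite summxE.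
    by apply: measurable_sum => k; apply: (measurableT_comp (f_meas i)).
  apply: le_trans (probability_le1 _ _) _.
    have -> : [set w | (eps * n%:R < enorm (\sum_(k < n) f (X k w)))%R] =
        setT `&` (fun w => enorm (\sum_(k < n) f (X k w))) @^-1` `]eps * n%:R, +oo[.
      by rewrite setTI; apply/seteqP; split => w; rewrite /= in_itv/= andbT.
    exact: mS.
  rewrite lee_fin -[leLHS]addr0 lerD ?expR_ge0//.
  have Mt := M1 _ (ltW yF0).
  rewrite ler_pdivlMr ?(lt_le_trans ltr01)// mul1r.
  apply: (@le_trans _ _ (Phi_inv phi t0)).
    by apply: Phi_inv_le => //; exact: ltW.
  by apply: le_trans n1 _; rewrite ler_peMl// ltW.
have N_le z : c^-1 <= z -> N * expR (- (3 * z)) <= expR (- (2 * z)).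
  move=> cz; have -> : - (3 * z) = - (2 * z) - z by ring.
  rewrite expRD mulrCA -[leRHS]mulr1 ler_wpM2l ?expR_ge0//.
  rewrite expRN ler_pdivrMr ?expR_gt0// mul1r.
  apply: le_trans (expR_ge1Dx z); rewrite /c invrK in cz; lra.
have [yle|ygt] := leP y (c * (eps * n%:R)).
  have cx : c^-1 <= x.
    by rewrite /x ler_pdivlMr// mulrC ler_pdivrMr// mulrC.
  apply: le_trans (core _ tge _ _ Pr X hX n n_pos) _.
  rewrite lee_fin lerD2l.
  have -> : eps * n%:R / (F * (y / F)) = x by rewrite /x; field; rewrite !gt_eqF.
  apply: le_trans (N_le _ cx) _.
  by rewrite ler_expR lerN2 ler_peMl// ?ler1n// ltW.
(* Now y > c eps n, and the estimate is taken at this smaller level. Its first term is at most gam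
   because Phi (L n / gam) <= eta L n / gam = t. *)
pose t := c * (eps * n%:R) / F.
have t_t0 : t0 <= t.
  by rewrite /t ler_pdivlMr// [leRHS]mulrA [leRHS]mulrC -ler_pdivrMr ?mulr_gt0.
have t_0 : 0 < t by exact: lt_le_trans t_t0.
apply: le_trans (core _ t_t0 _ _ Pr X hX n n_pos) _.
have -> : eps * n%:R / (F * t) = c^-1 by rewrite /t; field; rewrite !gt_eqF.
have small : L * n%:R / Phi_inv phi t <= gam.
  have Mt := M1 _ (ltW t_0).
  rewrite ler_pdivrMr ?(lt_le_trans ltr01 Mt)// [leRHS]mulrC -ler_pdivrMr//.
  have vv : v0 <= L * n%:R / gam.
    by rewrite ler_pdivlMr// [leRHS]mulrC -ler_pdivrMr.
  have v1 := le_trans v01 vv.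
  apply: (Phi_le_inv phi_ge0 phi_homo phi1) => //.
  rewrite Phi_invK ?(ltW t_0)//.
  have := hv0 _ vv; have -> : eta * (L * n%:R / gam) = t.
    by rewrite /eta /t; field; rewrite !gt_eqF.
  lra.
have xc : x <= c^-1.
  by rewrite /x ler_pdivrMr// [leRHS]mulrC ler_pdivlMr// [leLHS]mulrC ltW.
rewrite lee_fin.
have h1 := N_le _ (lexx c^-1).
have h2 : expR (- c^-1) <= expR (- x) by rewrite ler_expR lerN2.
have h3 := Ldiv _ (ltW yF0).
by move: small; rewrite /gam; lra.
Qed.
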